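(* Let $R$ be a commutative Noetherian ring with identity, $\mathfrak{a}$ an ideal of $R$ and $M$ a finitely generated $R$-module. Assume that $c:=\mathrm{cd}(\mathfrak{a},M)=\mathrm{ara}(\mathfrak{a},M)>0$. Consider the following conditions: (i) For every generating set $\{b_1,\ldots,b_t\}$ of $\mathfrak{a}$, the natural map $\lambda^i_M:H^i(b_1,\ldots,b_t,M)\to H^i_{\mathfrak{a}}(M)$ is surjective for all $0\le i\le c-1$. (ii) There exists an $\mathrm{f}$-generating set $\{a_1,\ldots,a_s\}$ of $\mathfrak{a}$ with respect to $M$ such that the natural map $\lambda^i_M:H^i(a_1,\ldots,a_s,M)\to H^i_{\mathfrak{a}}(M)$ is surjective for all $0\le i\le c-1$. (iii) $M$ is $\mathfrak{a}$-relative Buchsbaum. (iv) Every $\mathfrak{a}$-s.o.p of $M$ is a $u.s.d$-sequence on $M$. Then (i) and (ii) are equivalent, and (iii) implies (iv). Furthermore, if $\mathfrak{a}$ is contained in the Jacobson radical of $R$, then (i) implies (iii).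
   Context: Dimensions. $\mathrm{cd}(\mathfrak{a},M)$ is the supremum of the integers $i\ge 0$ with $H^i_{\mathfrak{a}}(M)\ne 0$ (with $\sup\emptyset=-\infty$), $H^i_{\mathfrak{a}}$ being local cohomology. $\mathrm{ara}(\mathfrak{a},M)$ is the infimum of the integers $n\ge 0$ for which there exist $x_1,\ldots,x_n\in R$ such that $\langle x_1,\ldots,x_n\rangle$ and $\mathfrak{a}$ have the same radical in $R/\mathrm{Ann}_R M$. With $c=\mathrm{cd}(\mathfrak{a},M)$, a sequence $x_1,\ldots,x_c$ of elements of $\mathfrak{a}$ is an $\mathfrak{a}$-relative system of parameters ($\mathfrak{a}$-s.o.p) of $M$ if $\langle x_1,\ldots,x_c\rangle$ and $\mathfrak{a}$ have the same radical in $R/\mathrm{Ann}_R M$. Sequences. A sequence $x_1,\ldots,x_r$ in $R$ is an $\mathfrak{a}$-filter regular sequence on $M$ if $\langle x_1,\ldots,x_{i-1}\rangle M:_M x_i\subseteq\bigcup_{t\in\mathbb{N}}\left(\langle x_1,\ldots,x_{i-1}\rangle M:_M\mathfrak{a}^t\right)$ for all $i=1,\ldots,r$; it is unconditioned if this holds in any order. It is an $\mathfrak{a}$-weak sequence on $M$ if $\langle x_1,\ldots,x_{i-1}\rangle M:_M x_i\subseteq\langle x_1,\ldots,x_{i-1}\rangle M:_M\mathfrak{a}$ for all $i=1,\ldots,r$. It is a $d$-sequence on $M$ if $\langle x_1,\ldots,x_{i-1}\rangle M:_M x_ix_j=\langle x_1,\ldots,x_{i-1}\rangle M:_M x_j$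 for all $1\le i\le j\le r$; a strong $d$-sequence on $M$ if $x_1^{n_1},\ldots,x_r^{n_r}$ is a $d$-sequence on $M$ for all $n_1,\ldots,n_r\in\mathbb{N}$ (positive integers); and a $u.s.d$-sequence on $M$ if it is a strong $d$-sequence on $M$ in any order. An $\mathrm{f}$-generating set of $\mathfrak{a}$ with respect to $M$ is a (finite) set of generators of $\mathfrak{a}$ which form an unconditioned $\mathfrak{a}$-filter regular sequence on $M$. $M$ is $\mathfrak{a}$-relative Buchsbaum if $\mathrm{cd}(\mathfrak{a},M)=\mathrm{ara}(\mathfrak{a},M)$ and every $\mathfrak{a}$-s.o.p of $M$ is an $\mathfrak{a}$-weak sequence on $M$. Koszul (co)homology. For $\underline{x}=x_1,\ldots,x_s$ in $R$, $K_\bullet(\underline{x},M)$ is the Koszul complex, $H_p(\underline{x},M)$ its homology, and $H^i(\underline{x},M):=H_{s-i}(\underline{x},M)$. For $1\le u\le v$ there is a chain map $K_\bullet(x_1^u,\ldots,x_s^u,M)\to K_\bullet(x_1^v,\ldots,x_s^v,M)$ which in degree $p$ multiplies the component at the basis element $e_{j_1}\wedge\cdots\wedge e_{j_p}$ by $\prod_{j\notin\{j_1,\ldots,j_p\}}x_j^{v-u}$. These form a direct system and there is a natural isomorphism $H^i_{\langle\underline{x}\rangle}(M)\cong\varinjlim_{u}H_{s-i}(x_1^u,\ldots,x_s^u,M)$. The natural map $\lambda^i_M:H^i(\underline{x},M)\to H^i_{\langle\underline{x}\rangle}(M)$ is the resulting map from the term $u=1$ to the direct limit. *)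

(* Defs.v *)
From HB Require Import structures.
From mathcomp Require Import all_boot all_order all_algebra perm.
From mathcomp Require Import boolp classical_sets functions constructive_ereal.

Set Implicit Arguments.
Unset Strict Implicit.
Unset Printing Implicit Defensive.

Import Order.TTheory GRing.Theory Num.Theory.
Local Open Scope classical_set_scope.
Local Open Scope ring_scope.

Section Submodules.
Variables (R : comPzRingType) (M : lmodType R).

Definition is_submodule (N : set M) : Prop := GRing.submod_closed [in N].

Definition submodule_gen (S : set M) : set M := smallest is_submodule S.

Definition finitely_generated : Prop :=
  exists (n : nat) (g : 'I_n -> M), submodule_gen (range g) = setT.

Definition annihilator : set R := [set r | forall m : M, r *: m = 0].

Definition colon (N : set M) (S : set R) : set M :=
  [set m | forall r, S r -> N (r *: m)].

End Submodules.

Section Ideals.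
Variable R : comPzRingType.

Definition is_ideal (I : set R) : Prop := @is_submodule R R^o I.

Definition ideal_gen (S : set R) : set R := @submodule_gen R R^o S.

Definition noetherian : Prop :=
  forall I : set R, is_ideal I ->
    exists (n : nat) (g : 'I_n -> R), ideal_gen (range g) = I.

Definition ideal_pow (I : set R) (t : nat) : set R :=
  ideal_gen [set r | exists2 f : 'I_t -> R,
                       (forall k, I (f k)) & r = \prod_(k < t) f k].

(* The preimage in R of the radical of the ideal of R / J generated by the
   image of the ideal I. *)
Definition radical_mod (J I : set R) : set R :=
  [set r | exists n : nat, exists2 y, I y & J (r ^+ n - y)].

Definition maximal_ideal (m : set R) : Prop :=
  [/\ is_ideal m, m <> setT &
      forall J : set R, is_ideal J -> m `<=` J -> J = m \/ J = setT].

Definition jacobson_radical : set R := \bigcap_(m in maximal_ideal) m.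

Definition ideal_mul (M : lmodType R) (I : set R) : set M :=
  submodule_gen [set v | exists r, exists2 m : M, I r & v = r *: m].

End Ideals.

Arguments jacobson_radical R : clear implicits.

Arguments ideal_mul {R} M I.

(* A family x : 'I_r -> R stands for the sequence usually indexed x_1, ..., x_r. *)
Definition prefix_ideal (R : comPzRingType) (r : nat) (x : 'I_r -> R) (i : 'I_r)
    : set R :=
  ideal_gen (x @` [set j : 'I_r | (j < i)%N]).

Section LocalCohomology.
Variable R : comPzRingType.

Definition injective_module (E : lmodType R) : Prop :=
  forall (A B : lmodType R) (f : {linear A -> B}) (g : {linear A -> E}),
    injective f -> exists h : {linear B -> E}, forall x, h (f x) = g x.

Record injective_resolution (M : lmodType R) := InjectiveResolution {
  res_obj :> nat -> lmodType R;
  res_diff : forall n, {linear res_obj n -> res_obj n.+1};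
  res_aug : {linear M -> res_obj 0};
  res_injective : forall n, injective_module (res_obj n);
  res_aug_inj : injective res_aug;
  res_exact0 : range res_aug = [set z | res_diff 0 z = 0];
  res_exactS : forall n, range (res_diff n) = [set z | res_diff n.+1 z = 0] }.

Definition torsion (M : lmodType R) (a : set R) : set M :=
  [set m | exists t : nat, forall r, ideal_pow a t r -> r *: m = 0].

Definition lc_cocycles (a : set R) (M : lmodType R)
    (E : injective_resolution M) (i : nat) : set (E i) :=
  [set z | torsion (M := E i) a z /\ res_diff E i z = 0].

Definition lc_coboundaries (a : set R) (M : lmodType R)
    (E : injective_resolution M) (i : nat) : set (E i) :=
  match i return set (E i) with
  | 0%N => [set 0]
  | j.+1 => res_diff E j @` torsion (M := E j) a
  end.

End LocalCohomology.

Arguments lc_cocycles {R} a {M} E i.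
Arguments lc_coboundaries {R} a {M} E i.

(* H^i_a(M) is the i-th right derived functor at M of the a-torsion functor,
   computed from an injective resolution of M; its vanishing does not depend
   on the resolution. *)
Definition local_cohomology_neq0 (R : comPzRingType) (a : set R) (M : lmodType R)
    (i : nat) : Prop :=
  exists E : injective_resolution M,
    ~ (lc_cocycles a E i `<=` lc_coboundaries a E i).

Definition cd (R : comPzRingType) (a : set R) (M : lmodType R) : \bar int :=
  supremum (-oo)%E
    [set i%:Z%:E%E | i in [set i : nat | local_cohomology_neq0 a M i]].

Section RelativeNotions.
Variables (R : comPzRingType) (a : set R) (M : lmodType R).

Definition same_radical (n : nat) (x : 'I_n -> R) : Prop :=
  radical_mod (annihilator M) (ideal_gen (range x)) =
  radical_mod (annihilator M) a.

Definition ara : \bar int :=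
  infimum (+oo)%E
    [set n%:Z%:E%E | n in [set n : nat | exists x : 'I_n -> R, same_radical x]].

Definition relative_sop (r : nat) (x : 'I_r -> R) : Prop :=
  [/\ cd a M = r%:Z%:E%E, forall j, a (x j) & same_radical x].

Definition filter_regular (r : nat) (x : 'I_r -> R) : Prop :=
  forall i : 'I_r,
    colon (ideal_mul M (prefix_ideal x i)) [set x i] `<=`
    \bigcup_t colon (ideal_mul M (prefix_ideal x i)) (ideal_pow a t).

Definition unconditioned_filter_regular (r : nat) (x : 'I_r -> R) : Prop :=
  forall s : 'S_r, filter_regular (x \o s).

Definition weak_sequence (r : nat) (x : 'I_r -> R) : Prop :=
  forall i : 'I_r,
    colon (ideal_mul M (prefix_ideal x i)) [set x i] `<=`
    colon (ideal_mul M (prefix_ideal x i)) a.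

Definition f_generating (r : nat) (x : 'I_r -> R) : Prop :=
  ideal_gen (range x) = a /\ unconditioned_filter_regular x.

Definition relative_Buchsbaum : Prop :=
  cd a M = ara /\
  forall (r : nat) (x : 'I_r -> R), relative_sop x -> weak_sequence x.

End RelativeNotions.

Section DSequences.
Variables (R : comPzRingType) (M : lmodType R).

Definition d_sequence (r : nat) (x : 'I_r -> R) : Prop :=
  forall i j : 'I_r, (i <= j)%N ->
    colon (ideal_mul M (prefix_ideal x i)) [set x i * x j] =
    colon (ideal_mul M (prefix_ideal x i)) [set x j].

Definition strong_d_sequence (r : nat) (x : 'I_r -> R) : Prop :=
  forall n : 'I_r -> nat, (forall j, (0 < n j)%N) ->
    d_sequence (fun j => x j ^+ n j).

Definition usd_sequence (r : nat) (x : 'I_r -> R) : Prop :=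
  forall s : 'S_r, strong_d_sequence (x \o s).

End DSequences.

Section Koszul.
Variables (R : comPzRingType) (M : lmodType R) (s : nat).
Implicit Types (x : 'I_s -> R) (p : int) (u v : nat).

(* The total module of K(x, M): the value at J = {j_1 < ... < j_p} is the
   component at e_{j_1} /\ ... /\ e_{j_p}. *)
Definition koszul : lmodType R := {ffun {set 'I_s} -> M}.

Definition koszul_chains p : set koszul :=
  [set f | forall J : {set 'I_s}, #|J|%:Z != p -> f J = 0].

Definition koszul_diff x (f : koszul) : koszul :=
  [ffun I : {set 'I_s} =>
    \sum_(j < s | j \notin I)
       ((-1) ^+ #|[set k in I | (k < j)%N]%SET| * x j) *: f (j |: I)%SET].

Definition koszul_cycles x p : set koszul :=
  [set f | koszul_chains p f /\ koszul_diff x f = 0].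

Definition koszul_boundaries x p : set koszul :=
  koszul_diff x @` koszul_chains (p + 1).

Definition koszul_class x p (z : koszul) : set koszul :=
  [set w | koszul_cycles x p w /\ koszul_boundaries x p (w - z)].

(* H_p(x, M), as the set of classes of cycles modulo boundaries. *)
Definition koszul_homology x p : set (set koszul) :=
  koszul_class x p @` koszul_cycles x p.

Definition powers x u : 'I_s -> R := fun j => x j ^+ u.

(* K(x^u, M) -> K(x^v, M) *)
Definition koszul_trans x u v (f : koszul) : koszul :=
  [ffun J : {set 'I_s} => (\prod_(j < s | j \notin J) x j ^+ (v - u)) *: f J].

(* The direct limit over u >= 1 of the H_p(x^u, M), as the set of classes of
   pairs (u, z), z a cycle of degree p of K(x^u, M). *)
Definition koszul_germs x p : set (nat * koszul) :=
  [set g | (0 < g.1)%N /\ koszul_cycles (powers x g.1) p g.2].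

Definition germ_eq x p (g h : nat * koszul) : Prop :=
  exists k : nat, [/\ (g.1 <= k)%N, (h.1 <= k)%N &
    koszul_boundaries (powers x k) p
      (koszul_trans x g.1 k g.2 - koszul_trans x h.1 k h.2)].

Definition germ_class x p (g : nat * koszul) : set (nat * koszul) :=
  [set h | koszul_germs x p h /\ germ_eq x p g h].

Definition koszul_colim x p : set (set (nat * koszul)) :=
  germ_class x p @` koszul_germs x p.

Definition to_koszul_colim x p (X : set koszul) : set (nat * koszul) :=
  \bigcup_(z in X) germ_class x p (1%N, z).

(* lambda^i_M : H^i(x, M) -> H^i_<x>(M) is surjective, where
   H^i(x, M) = H_(s-i)(x, M) and H^i_<x>(M) is identified with the direct limit
   of the H_(s-i)(x^u, M). *)
Definition lambda_surjective x (i : nat) : Prop :=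
  set_surj (koszul_homology x (s%:Z - i%:Z)) (koszul_colim x (s%:Z - i%:Z))
           (to_koszul_colim x (s%:Z - i%:Z)).

End Koszul.

Arguments lambda_surjective {R} M {s} x i.

(* Main.v *)
(* Everything is done relative to a submodule N of M in place of the quotient
   M/N: a cycle of K(x, M/N) is a chain of K(x, M) whose boundary has values
   in N.

   Inserting into a sequence an element y of the ideal it generates makes the
   Koszul complex the cone of multiplication by y, which is null-homotopic. The
   local cohomology does not change and the homology splits, so the surjectivity
   of lambda^i does not depend on the generators. Hence (i) and (ii) are
   equivalent, as f-generating sets exist by prime avoidance.

   For (i) => (iii), surjectivity of lambda^0 says that the a-torsion of M is
   0 :_M a. If y in a satisfies 0 :_M y = 0 :_M a, a chase in the long exact
   sequences passes the surjectivity in degrees < c from M to M/yM in degrees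
   < c - 1. So it suffices that the first element x_1 of an s.o.p. is filter
   regular: by induction on c, this holds on M/y^k M for all k, where y is a
   filter regular element replacing x_2, and Krull's intersection theorem
   (a lies in the Jacobson radical) carries it back to M. *)

Require Import Defs.
From HB Require Import structures.
From mathcomp Require Import all_boot all_order all_algebra perm.
From mathcomp Require Import boolp classical_sets functions constructive_ereal.
From mathcomp Require Import zify ring.

Set Implicit Arguments.
Unset Strict Implicit.
Unset Printing Implicit Defensive.

Import Order.TTheory GRing.Theory Num.Theory.
Local Open Scope classical_set_scope.
Local Open Scope ring_scope.

(** * Submodules, ideals and prime avoidance *)

Section Submodules.
Variables (R : comPzRingType) (M : lmodType R).
Implicit Types (N S : set M) (m : M) (r : R).

Lemma submoduleP N :
  is_submodule N <->
  [/\ N 0, forall m m', N m -> N m' -> N (m + m') & forall r m, N m -> N (r *: m)].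
Proof.
rewrite /is_submodule /GRing.submod_closed; split=> [[]|[N0 ND NZ]].
  rewrite in_setE => N0 NL; split=> // [m m' Nm Nm'|r m Nm].
    by have := NL 1 m m'; rewrite !inE scale1r; apply.
  by have := NL r m 0; rewrite !inE addr0; apply.
split; first by rewrite inE.
by move=> r m m'; rewrite !inE => Nm Nm'; apply: ND => //; apply: NZ.
Qed.

Section Closure.
Variables (N : set M) (N_sub : is_submodule N).

Lemma submod0 : N 0. Proof. by have /submoduleP[] := N_sub. Qed.

Lemma submodD m m' : N m -> N m' -> N (m + m').
Proof. by have /submoduleP[_ + _] := N_sub; apply. Qed.

Lemma submodZ r m : N m -> N (r *: m).
Proof. by have /submoduleP[_ _] := N_sub; apply. Qed.

Lemma submodN m : N m -> N (- m).
Proof. by rewrite -scaleN1r; apply: submodZ. Qed.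

Lemma submodB m m' : N m -> N m' -> N (m - m').
Proof. by move=> Nm Nm'; apply/submodD/submodN. Qed.

Lemma submodB_sym m m' : N (m - m') -> N (m' - m).
Proof. by move=> /submodN; rewrite opprB. Qed.

Lemma submod_trans m1 m2 m3 : N (m1 - m2) -> N (m2 - m3) -> N (m1 - m3).
Proof. by move=> N12 N23; rewrite -(subrK m2 m1) -addrA; apply: submodD. Qed.

Lemma submod_congr m m' : N (m - m') -> N m' -> N m.
Proof. by move=> Nd Nm'; rewrite -(subrK m' m); apply: submodD. Qed.

Lemma submod_sum (I : Type) (s : seq I) (P : pred I) (F : I -> M) :
  (forall i, P i -> N (F i)) -> N (\sum_(i <- s | P i) F i).
Proof. by move=> NF; elim/big_ind: _ => //; [apply: submod0 | apply: submodD]. Qed.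

End Closure.

Lemma submod_set0 : is_submodule ([set 0] : set M).
Proof. by apply/submoduleP; split=> //= [m m' -> ->|r m ->]; rewrite ?addr0 ?scaler0. Qed.

Lemma submod_setI N N' : is_submodule N -> is_submodule N' -> is_submodule (N `&` N').
Proof.
move=> sN sN'; apply/submoduleP; split=> [|m m' [? ?] [? ?]|r m [? ?]].
- by split; apply: submod0.
- by split; apply: submodD.
- by split; apply: submodZ.
Qed.

Lemma submodule_gen_sub S : is_submodule (submodule_gen S).
Proof.
apply/submoduleP; split=> [N [sN _]|m m' Sm Sm' N [sN SN]|r m Sm N [sN SN]].
- exact: submod0.
- by apply: submodD => //; [apply: Sm | apply: Sm'].
- by apply: submodZ => //; apply: Sm.
Qed.

Lemma sub_submodule_gen S : S `<=` submodule_gen S.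
Proof. exact: sub_gen_smallest. Qed.

Lemma submodule_gen_min S N : is_submodule N -> S `<=` N -> submodule_gen S `<=` N.
Proof. exact: smallest_sub. Qed.

Lemma submodule_genS S S' : S `<=` S' -> submodule_gen S `<=` submodule_gen S'.
Proof.
move=> sub; apply: submodule_gen_min; first exact: submodule_gen_sub.
by apply: (subset_trans sub); apply: sub_submodule_gen.
Qed.

(** The submodule N + yM, that is, the preimage in M of y(M/N); membership is a congruence modulo N,
    like every statement about the quotient M/N below. *)
Definition add_mul N (y : R) : set M := [set m | exists m', N (m - y *: m')].

Lemma add_mul_sub N y : is_submodule N -> is_submodule (add_mul N y).
Proof.
move=> sN; apply/submoduleP; split=> [|m m' [n Nn] [n' Nn']|r m [n Nn]].
- by exists 0; rewrite scaler0 subr0; apply: submod0.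
- by exists (n + n'); rewrite scalerDr opprD addrACA; apply: submodD.
- by exists (r *: n); rewrite scalerA mulrC -scalerA -scalerBr; apply: submodZ.
Qed.

Lemma sub_add_mul N y : N `<=` add_mul N y.
Proof. by move=> m Nm; exists 0; rewrite scaler0 subr0. Qed.

Lemma add_mul_mem N y m : is_submodule N -> add_mul N y (y *: m).
Proof. by move=> sN; exists m; rewrite subrr; apply: submod0. Qed.

Lemma add_mul_min N y N' : is_submodule N' -> N `<=` N' ->
  (forall m, N' (y *: m)) -> add_mul N y `<=` N'.
Proof. by move=> sN' NN' yN' m [n /NN' /(submod_congr sN')]; apply. Qed.

Definition cyclic_ext N m0 : set M := [set m | exists r, N (m - r *: m0)].

Lemma cyclic_ext_sub N m0 : is_submodule N -> is_submodule (cyclic_ext N m0).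
Proof.
move=> sN; apply/submoduleP; split=> [|m m' [n Nn] [n' Nn']|r m [n Nn]].
- by exists 0; rewrite scale0r subr0; apply: submod0.
- by exists (n + n'); rewrite scalerDl opprD addrACA; apply: submodD.
- by exists (r * n); rewrite -scalerA -scalerBr; apply: submodZ.
Qed.

Lemma sub_cyclic_ext N m0 : N `<=` cyclic_ext N m0.
Proof. by move=> m Nm; exists 0; rewrite scale0r subr0. Qed.

Lemma cyclic_ext_mem N m0 : is_submodule N -> cyclic_ext N m0 m0.
Proof. by move=> sN; exists 1; rewrite scale1r subrr; apply: submod0. Qed.

End Submodules.

Section Ideals.
Variable R : comPzRingType.
Implicit Types (I J P : set R).

Lemma idealP I :
  is_ideal I <->
  [/\ I 0, forall r s, I r -> I s -> I (r + s) & forall r s, I s -> I (r * s)].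
Proof. exact: (@submoduleP R R^o). Qed.

Lemma ideal_mull I r s : is_ideal I -> I s -> I (r * s).
Proof. by move=> /idealP[_ _]; apply. Qed.

Lemma ideal0 I : is_ideal I -> I 0.
Proof. by move=> /idealP[]. Qed.

Lemma idealD I r s : is_ideal I -> I r -> I s -> I (r + s).
Proof. by move=> /idealP[_ + _]; apply. Qed.

Lemma idealB I r s : is_ideal I -> I r -> I s -> I (r - s).
Proof. by move=> sI Ir Is; apply: idealD => //; rewrite -mulN1r; apply: ideal_mull. Qed.

Lemma ideal_sum I (K : Type) (s : seq K) (Q : pred K) (F : K -> R) :
  is_ideal I -> (forall k, Q k -> I (F k)) -> I (\sum_(k <- s | Q k) F k).
Proof.
by move=> sI IF; elim/big_ind: _ => // [|*]; [apply: ideal0 | apply: idealD].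
Qed.

Lemma ideal_mulr I r s : is_ideal I -> I s -> I (s * r).
Proof. by move=> sI Is; rewrite mulrC; apply: ideal_mull. Qed.

Lemma ideal_genP (S : set R) : is_ideal (ideal_gen S).
Proof. exact: (@submodule_gen_sub R R^o). Qed.

Lemma sub_ideal_gen (S : set R) : S `<=` ideal_gen S.
Proof. exact: (@sub_submodule_gen R R^o). Qed.

Lemma ideal_gen_min (S I : set R) : is_ideal I -> S `<=` I -> ideal_gen S `<=` I.
Proof. exact: (@submodule_gen_min R R^o). Qed.

Lemma ideal_expS I r n k : is_ideal I -> (n <= k)%N -> I (r ^+ n) -> I (r ^+ k).
Proof. by move=> sI le_nk In; rewrite -(subnK le_nk) exprD; apply: ideal_mull. Qed.

(** In the binomial expansion of [(r + s) ^+ (n + k)] every term contains [r ^+ n] or [s ^+ k] as a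
    factor. *)
Lemma radical_ideal I : is_ideal I -> is_ideal [set r | exists n, I (r ^+ n)].
Proof.
move=> sI; apply/idealP; split=> /= [|r s [n In] [k Ik]|r s [n In]].
- by exists 1%N; rewrite expr1; apply: ideal0.
- exists (n + k)%N; rewrite exprDn; apply: ideal_sum => // i _.
  rewrite -[_ *+ _]mulr_natl; apply: ideal_mull => //.
  have [le_ki|lt_ik] := leqP k i.
    by apply: ideal_mull => //; apply: ideal_expS le_ki Ik.
  by apply: ideal_mulr => //; apply: ideal_expS In => //; lia.
- by exists n; rewrite exprMn; apply: ideal_mull.
Qed.

Lemma ideal_gen_radical (S I : set R) : is_ideal I ->
  (forall r, S r -> exists n, I (r ^+ n)) ->
  forall r, ideal_gen S r -> exists n, I (r ^+ n).
Proof. by move=> sI SI; apply: ideal_gen_min => //; apply: radical_ideal. Qed.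

Lemma ideal_gen_powers (s : nat) (b : 'I_s -> R) (e : 'I_s -> nat) y :
  ideal_gen (range b) y -> exists k, ideal_gen (range (fun j => b j ^+ e j)) (y ^+ k).
Proof.
apply: ideal_gen_radical; first exact: ideal_genP.
by move=> _ [j _ <-]; exists (e j); apply: sub_ideal_gen; exists j.
Qed.

Definition prime_ideal P : Prop :=
  [/\ is_ideal P, ~ P 1 & forall r s, P (r * s) -> P r \/ P s].

Lemma prime_exp P r n : prime_ideal P -> P (r ^+ n) -> P r.
Proof.
move=> [sP P1 PM]; elim: n => [|n IH]; first by rewrite expr0.
by rewrite exprS => /PM[].
Qed.

(** I and each Q contribute an element outside P; since P is prime, the product of these elements is
    still outside P. *)
Lemma prime_separation (ps : seq (set R)) P I :
  prime_ideal P -> is_ideal I -> (forall Q, Q \in ps -> is_ideal Q) ->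
  ~ (I `<=` P) -> (forall Q, Q \in ps -> ~ (Q `<=` P)) ->
  exists v, [/\ I v, forall Q, Q \in ps -> Q v & ~ P v].
Proof.
move=> [sP P1 PM] sI; elim: ps => [|Q ps IH] sQ nI nQ.
  have [v Iv nPv] : exists2 v, I v & ~ P v.
    by apply: contrapT => h; apply: nI => v Iv; apply: contrapT => nP; apply: h; exists v.
  by exists v.
have psQ Q' : Q' \in ps -> Q' \in Q :: ps by exact: (mem_behead (s := Q :: ps)).
have [v [Iv Qv nPv]] := IH (fun Q' h => sQ Q' (psQ _ h)) nI (fun Q' h => nQ Q' (psQ _ h)).
have [w Qw nPw] : exists2 w, Q w & ~ P w.
  apply: contrapT => h; apply: (nQ Q); first by rewrite inE eqxx.
  by move=> w Qw; apply: contrapT => nP; apply: h; exists w.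
exists (w * v); split; first by apply: ideal_mull.
  move=> Q'; rewrite inE => /orP[/eqP->|Q'ps].
    by apply: ideal_mulr => //; apply: sQ; rewrite inE eqxx.
  by apply: ideal_mull; [apply: sQ; rewrite inE Q'ps orbT | apply: Qv].
by case/PM.
Qed.

Lemma coset_prime_avoidance (ps : seq (set R)) (w : R) I : is_ideal I ->
  (forall P, P \in ps -> prime_ideal P /\ ~ (P w /\ I `<=` P)) ->
  exists2 r, I r & forall P, P \in ps -> ~ P (w + r).
Proof.
move=> sI; have [n] := ubnP (size ps); elim: n ps => // n IHn [|P ps] szn hps.
  by exists 0 => //; apply: ideal0.
have [pP nP] := hps P (mem_head _ _).
have [[Q Qps QP]|noQ] := pselect (exists2 Q, Q \in ps & Q `<=` P).
  have [||r Ir hr] := IHn (P :: rem Q ps).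
  - rewrite /= size_rem //; move: szn => /=; case: (ps) Qps => //= *; lia.
  - move=> P'; rewrite inE => /orP[/eqP->//|/mem_rem P'ps].
    by apply: hps; rewrite inE P'ps orbT.
  exists r => // P'; rewrite inE => /orP[/eqP->|]; first by apply: hr; apply: mem_head.
  rewrite (perm_mem (perm_to_rem Qps)) inE => /orP[/eqP->|P'ps].
    by move=> /QP; apply: hr; apply: mem_head.
  by apply: hr; rewrite inE P'ps orbT.
have [||r Ir hr] := IHn ps; first by move: szn => /=; lia.
  by move=> P' P'ps; apply: hps; rewrite inE P'ps orbT.
have [Pwr|nPwr] := pselect (P (w + r)); last first.
  by exists r => // P'; rewrite inE => /orP[/eqP->//|/hr].
have [sP P1 PM] := pP.
have [|||v [Iv Qv nPv]] := prime_separation (ps := ps) pP sI.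
- by move=> Q Qps; have [[]] := hps Q (mem_behead (s := P :: ps) Qps).
- by move=> IP; apply: nP; split=> //; have := idealB sP Pwr (IP _ Ir); rewrite addrK.
- by move=> Q Qps QP; apply: noQ; exists Q.
exists (r + v); first exact: idealD.
move=> P'; rewrite inE addrA => /orP[/eqP->|P'ps] Pv.
  by apply: nPv; have := idealB sP Pv Pwr; rewrite [X in P X](_ : _ = v) //; ring.
have [[sP' _ _] _] := hps P' (mem_behead (s := P :: ps) P'ps).
by apply: (hr P' P'ps); have := idealB sP' Pv (Qv _ P'ps); rewrite addrK.
Qed.

End Ideals.

Lemma colon_ideal (R : comPzRingType) (M : lmodType R) (N : set M) m :
  is_submodule N -> is_ideal [set r | N (r *: m)].
Proof.
move=> sN; apply/idealP; split=> /= [|r r' Nr Nr'|r r' Nr].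
- by rewrite scale0r; apply: submod0.
- by rewrite scalerDl; apply: submodD.
- by rewrite -scalerA; apply: submodZ.
Qed.

(** * Noetherian modules *)

Definition maximum_condition (R : comPzRingType) (M : lmodType R) : Prop :=
  forall F : set (set M), F !=set0 -> (forall N, F N -> is_submodule N) ->
    exists2 N, F N & forall N', F N' -> N `<=` N' -> N' `<=` N.

Section Noetherian.
Variables (R : comPzRingType) (R_noeth : noetherian R).

Section Modules.
Variable M : lmodType R.
Implicit Types N : set M.

Definition finitely_spanned N : Prop :=
  exists l : seq M, submodule_gen [set m | m \in l] = N.

(** Zorn's lemma applies because the union of a nonempty chain is finitely spanned, and finitely
    many generators already lie in one member of the chain. *)
Lemma finitely_spanned_max_cond :
  (forall N, is_submodule N -> finitely_spanned N) -> maximum_condition M.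
Proof.
move=> fgM F [N0 FN0] sF.
pose P N := F N \/ N = set0.
have [C CP totC|N [PN maxN]] := Zorn_bigcup (P := P).
  have [[N1 [CN1 FN1]]|noC] := pselect (exists N, C N /\ F N); last first.
    right; apply/seteqP; split=> // m [N CN Nm].
    by have [FN|N_0] := CP _ CN; [apply: noC; exists N | rewrite N_0 in Nm].
  have big2 N N' : C N -> C N' -> exists2 L, C L & N `|` N' `<=` L.
    move=> CN CN'; have [NN'|N'N] := totC _ _ CN CN'.
      by exists N' => // m [/NN'|].
    by exists N => // m [|/N'N].
  have nonempty_sub N : C N -> N !=set0 -> is_submodule N.
    by move=> CN [m Nm]; have [/sF//|N_0] := CP _ CN; rewrite N_0 in Nm.
  have sU : is_submodule (\bigcup_(N in C) N).
    apply/submoduleP; split=> [|m m' [N CN Nm] [N' CN' Nm']|r m [N CN Nm]].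
    - by exists N1 => //; apply: submod0; apply: sF.
    - have [L CL NL] := big2 _ _ CN CN'; exists L => //.
      have Lm : L m by apply: NL; left.
      by apply: submodD => //; [apply: nonempty_sub => //; exists m | apply: NL; right].
    - by exists N => //; apply: submodZ => //; apply: nonempty_sub => //; exists m.
  have [l genl] := fgM _ sU; left.
  have [L CL [N1L lL]] : exists2 L, C L & N1 `<=` L /\ [set m | m \in l] `<=` L.
    have : [set m | m \in l] `<=` \bigcup_(N in C) N.
      by rewrite -genl; apply: sub_submodule_gen.
    elim: l {genl} => [|m l IHl] lU; first by exists N1 => //; split=> // m.
    have [|L CL [N1L lL]] := IHl.
      by move=> m' m'l; apply: lU; exact: (mem_behead (s := m :: l)).
    have [N CN Nm] := lU m (mem_head _ _).
    have [L' CL' NL'] := big2 _ _ CN CL; exists L' => //; split=> m'.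
      by move=> /N1L Lm'; apply: NL'; right.
    by rewrite /= inE => /orP[/eqP->|m'l]; apply: NL'; [left | right; apply: lL].
  have sL : is_submodule L.
    by apply: nonempty_sub => //; exists 0; apply: N1L; apply: submod0; apply: sF.
  have -> : \bigcup_(N in C) N = L.
    apply/seteqP; split; last by move=> m Lm; exists L.
    by rewrite -genl; apply: submodule_gen_min.
  by have [//|L_0] := CP _ CL; have := submod0 sL; rewrite L_0.
case: PN => [FN|N_0]; last first.
  case: (maxN N0); last by left.
  by rewrite N_0; split=> // /(_ 0); apply; apply: submod0; apply: sF.
exists N => // N' FN' NN'; apply: contrapT => N'N.
by apply: (maxN N'); [split | left].
Qed.

Lemma submodule_gen_cons g (l : seq M) m :
  submodule_gen [set x | x \in g :: l] m ->
  cyclic_ext (submodule_gen [set x | x \in l]) g m.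
Proof.
have sl := submodule_gen_sub [set x | x \in l].
move: m; apply: submodule_gen_min => [|x]; first exact: cyclic_ext_sub.
rewrite /= inE => /orP[/eqP->|xl]; first exact: cyclic_ext_mem.
by apply: sub_cyclic_ext; apply: sub_submodule_gen.
Qed.

(** Induction on a list of generators [g :: l] whose span contains N. With L the span of [l], the
    submodule N is spanned by generators of its intersection with L and by lifts of generators of
    the ideal of coefficients that g takes in elements of N. *)
Lemma finitely_spanned_sub : finitely_generated M ->
  forall N, is_submodule N -> finitely_spanned N.
Proof.
move=> [n [g gM]] N sN.
have : N `<=` submodule_gen [set m | m \in codom g].
  suff -> : submodule_gen [set m | m \in codom g] = setT by [].
  apply/seteqP; split=> //; rewrite -gM; apply: submodule_genS => _ [i _ <-].
  exact: codom_f.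
elim: (codom g) N sN => {n g gM} [|g l IHl] N sN Nl.
  exists [::]; apply/seteqP; split.
    by apply: submodule_gen_min.
  by apply: subset_trans Nl _; apply: submodule_genS.
set L := submodule_gen _ in IHl.
have sL : is_submodule L by apply: submodule_gen_sub.
have [l0 genl0] : finitely_spanned (N `&` L).
  by apply: IHl; [apply: submod_setI | move=> ? []].
pose I := [set r | exists2 m, L m & N (r *: g + m)].
have sI : is_ideal I.
  apply/idealP; split=> [|r s [m Lm Nm] [m' Lm' Nm']|r s [m Lm Nm]].
  - exists 0; first exact: (submod0 sL).
    by rewrite scale0r addr0; apply: submod0.
  - exists (m + m'); first exact: (submodD sL).
    by rewrite scalerDl addrACA; apply: submodD.
  - exists (r *: m); first exact: (submodZ sL).
    by rewrite -scalerA -scalerDr; apply: submodZ.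
have [k [rho genI]] := R_noeth sI.
have /choice[h hP] : forall j : 'I_k, exists m, L m /\ N (rho j *: g + m).
  move=> j; have [m Lm Nm] : I (rho j) by rewrite -genI; apply: sub_ideal_gen; exists j.
  by exists m.
pose l1 := l0 ++ [seq rho j *: g + h j | j : 'I_k].
have sl1 := submodule_gen_sub [set m | m \in l1].
have l1N : submodule_gen [set m | m \in l1] `<=` N.
  apply: submodule_gen_min => // m; rewrite /= mem_cat => /orP[ml0|/mapP[j _ ->]].
    have : (N `&` L) m by rewrite -genl0; apply: sub_submodule_gen.
    by case.
  by have [] := hP j.
have I_lift r : I r ->
    exists2 v, submodule_gen [set m | m \in l1] v & L (v - r *: g).
  move: r; rewrite -genI; apply: ideal_gen_min.
    apply/idealP; split=> /= [|r s [v lv Lv] [w lw Lw]|r s [v lv Lv]].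
    - exists 0; first exact: (submod0 sl1).
      by rewrite scale0r subr0; apply: (submod0 sL).
    - exists (v + w); first exact: (submodD sl1).
      by rewrite scalerDl opprD addrACA; apply: (submodD sL).
    - exists (r *: v); first exact: (submodZ sl1).
      by rewrite -scalerA -scalerBr; apply: (submodZ sL).
  move=> _ [j _ <-]; exists (rho j *: g + h j).
    apply: sub_submodule_gen; rewrite /= mem_cat; apply/orP; right.
    by apply/mapP; exists j; rewrite ?mem_enum.
  by rewrite addrC addKr; have [] := hP j.
exists l1; apply/seteqP; split=> // m Nm.
have [r Lr] := submodule_gen_cons (Nl _ Nm).
have [|v lv Lv] := I_lift r.
  by exists (m - r *: g) => //; rewrite addrC subrK.
apply: (submod_congr sl1 _ lv).
have : (N `&` L) (m - v).
  split; first by apply: submodB => //; apply: l1N.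
  by apply: (submod_trans sL Lr); apply: (submodB_sym sL).
rewrite -genl0; apply: submodule_genS => x xl0.
by rewrite /= mem_cat; apply/orP; left.
Qed.

Lemma fg_max_cond : finitely_generated M -> maximum_condition M.
Proof. by move=> /finitely_spanned_sub; apply: finitely_spanned_max_cond. Qed.

End Modules.

Lemma noetherian_max_cond : @maximum_condition R R^o.
Proof.
apply: finitely_spanned_max_cond => I sI; have [n [g gI]] := R_noeth sI.
exists (codom g); rewrite -gI; congr (submodule_gen _).
by apply/seteqP; split=> [x /codomP[i ->]|_ [i _ <-]]; [exists i | apply: codom_f].
Qed.

Lemma exists_maximal_ideal (I : set R) : is_ideal I -> ~ I 1 ->
  exists2 P, maximal_ideal P & I `<=` P.
Proof.
move=> sI I1; have [||P [sP IP P1] maxP] :=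
  noetherian_max_cond (F := [set J | [/\ is_ideal J, I `<=` J & ~ J 1]]).
- by exists I; split.
- by move=> J [].
exists P => //; split=> // [PT|J sJ PJ]; first by apply: P1; rewrite PT.
have [J1|nJ1] := pselect (J 1).
  by right; apply/seteqP; split=> // r _; rewrite -[r]mulr1; apply: ideal_mull.
left; apply/seteqP; split=> //; apply: maxP => //.
by split=> //; apply: subset_trans PJ.
Qed.

(** If [1 - y] were not invertible, it would lie in a maximal ideal, which contains y as well and
    hence 1. *)
Lemma jacobson_unit (y : R) : jacobson_radical R y -> exists v, v * (1 - y) = 1.
Proof.
move=> Jy; apply: contrapT => noinv.
have sI : is_ideal [set r | exists v, r = v * (1 - y)].
  apply/idealP; split=> [|_ _ [v ->] [w ->]|r _ [v ->]].
  - by exists 0; rewrite mul0r.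
  - by exists (v + w); rewrite mulrDl.
  - by exists (r * v); rewrite mulrA.
have [|P mP IP] := exists_maximal_ideal sI.
  by move=> [v v1]; apply: noinv; exists v.
have [sP PT _] := mP; apply: PT; apply/seteqP; split=> // r _.
rewrite -[r]mulr1; apply: ideal_mull => //.
rewrite -(subrK y 1); apply: idealD => //; last exact: Jy.
by apply: IP; exists 1; rewrite mul1r.
Qed.

End Noetherian.

(** The preimage of the a-torsion of M/N, tested on single elements of a with an exponent depending
    on the element; for finitely generated a, [power_torsion_ideal_pow] recovers a uniform power of
    a. *)
Definition power_torsion (R : comPzRingType) (M : lmodType R) (a : set R) (N : set M)
    : set M :=
  [set m | forall r, a r -> exists u : nat, N (r ^+ u *: m)].

(** * Avoiding primes to obtain filter regular elements *)

Section Avoidance.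
Variables (R : comPzRingType) (R_noeth : noetherian R).
Variables (M : lmodType R) (M_max : maximum_condition M).
Variables (a : set R) (N : set M) (N_sub : is_submodule N).

(* Noetherian induction on a submodule N' between N and M: if N' is not M, it
   is enlarged by an element m0 such that N' : m0 is maximal, hence prime. *)
Lemma primes_avoided_by_filter_regular :
  exists ps : seq (set R),
    (forall P, P \in ps ->
       [/\ prime_ideal P, ~ (a `<=` P) & forall r, (forall m, N (r *: m)) -> P r]) /\
    forall y, (forall P, P \in ps -> ~ P y) -> colon N [set y] `<=` power_torsion a N.
Proof.
pose good (ps : seq (set R)) := forall P, P \in ps ->
  [/\ prime_ideal P, ~ (a `<=` P) & forall r, (forall m, N (r *: m)) -> P r].
pose F := [set N' : set M | [/\ is_submodule N', N `<=` N' & exists2 ps, good ps &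
  forall y, (forall P, P \in ps -> ~ P y) ->
    forall m, N' m -> N (y *: m) -> power_torsion a N m]].
have [||N' [sN' NN' [ps ps_good psP]] maxN'] := M_max (F := F).
- exists N; split=> //; exists [::] => // y _ m Nm _ r _.
  by exists 0%N; rewrite expr0 scale1r.
- by move=> ? [].
suff N'T m : N' m.
  by exists ps; split=> // y yps m ym; apply: (psP _ yps) => //; apply: ym.
apply: contrapT => nN'm.
pose ann m := [set r | N' (r *: m)].
have [||P [m0 nN'm0 PE] maxP] := noetherian_max_cond R_noeth
  (F := [set P | exists2 m, ~ N' m & P = ann m]).
- by exists (ann m); exists m.
- by move=> _ [m' _ ->]; apply: colon_ideal.
have sP : is_ideal P by rewrite PE; apply: colon_ideal.
have P_prime : prime_ideal P.
  split=> //; first by rewrite PE /ann /= scale1r.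
  move=> r s; rewrite {1}PE /ann /= => Prs.
  have [|nPr] := pselect (P r); first by left.
  (* [ann (r *: m0)] contains P and is a member of the family because r is outside P, so maximality
     of P makes the two equal, and s lies in it. *)
  right; apply: (maxP (ann (r *: m0))).
  - by exists (r *: m0) => // N'r; apply: nPr; rewrite PE.
  - by move=> t; rewrite PE /ann /= scalerA mulrC -scalerA; apply: submodZ.
  - by rewrite /ann /= scalerA mulrC.
suff /maxN' : F (cyclic_ext N' m0).
  by move=> /(_ (@sub_cyclic_ext _ _ _ _)) /(_ m0 (cyclic_ext_mem _ sN')).
split; first exact: cyclic_ext_sub.
  by apply: subset_trans NN' _; apply: sub_cyclic_ext.
(* If a lies in P, then a maps the enlarged submodule into N' and no new prime is required:
   exponents grow by one. Otherwise P joins the list, and an element y outside P that sends [m1]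
   into N forces [m1] into N'. *)
have [aP|naP] := pselect (a `<=` P).
  exists ps => // y yps m1 [t N'm1] Nym1 r ar.
  have [||u Nu] := psP _ yps (r *: m1) _ _ r ar.
  - apply: (submod_congr sN') (_ : N' (t *: (r *: m0))).
      by rewrite scalerA mulrC -scalerA -scalerBr; apply: submodZ.
    by apply: submodZ => //; have := aP r ar; rewrite PE.
  - by rewrite scalerA mulrC -scalerA; apply: submodZ.
  - by exists u.+1; rewrite exprSr -scalerA.
exists (P :: ps).
  move=> Q; rewrite inE => /orP[/eqP->|/ps_good//]; split=> // r Nr.
  by rewrite PE; apply: NN'.
move=> y yps m1 [t N'm1] Nym1; apply: (psP y) => //.
  by move=> Q Qps; apply: yps; rewrite inE Qps orbT.
apply: (submod_congr sN' N'm1).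
have [_ _ PM] := P_prime; have : P (y * t).
  rewrite PE /ann /= -scalerA; apply: (submod_congr sN') (NN' _ Nym1).
  by rewrite -scalerBr; apply: submodZ => //; apply: submodB_sym.
by case/PM=> [/yps|]; [rewrite mem_head => /(_ isT) | rewrite PE].
Qed.

End Avoidance.

Section FilterRegularInCoset.
Variables (R : comPzRingType) (R_noeth : noetherian R).
Variables (M : lmodType R) (M_max : maximum_condition M).
Variable (a : set R).

(** The lists of primes attached to the finitely many [N k] are concatenated and avoided at once;
    none of these primes contains a, so by [hI] none contains both w and I. *)
Lemma filter_regular_in_coset (K : finType) (N : K -> set M) (w : R) (I : set R) :
  (forall k, is_submodule (N k)) -> is_ideal I ->
  (forall k P, prime_ideal P -> (forall r, (forall m, N k (r *: m)) -> P r) ->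
     P w -> I `<=` P -> a `<=` P) ->
  exists2 r, I r & forall k, colon (N k) [set w + r] `<=` power_torsion a (N k).
Proof.
move=> sN sI hI.
have /choice[ps psP] k := primes_avoided_by_filter_regular R_noeth M_max a (sN k).
have [|r Ir rP] := coset_prime_avoidance (ps := flatten [seq ps k | k : K]) (w := w) sI.
  move=> P /flattenP[_ /mapP[k _ ->] Pps]; have [/(_ P Pps)[pP naP NP] _] := psP k.
  by split=> // -[Pw IP]; apply: naP; apply: hI NP Pw IP.
exists r => // k; have [_] := psP k; apply=> P Pps; apply: rP.
by apply/flattenP; exists (ps k) => //; apply/mapP; exists k; rewrite ?mem_enum.
Qed.

End FilterRegularInCoset.

(** * Krull's intersection theorem *)

Section KrullIntersection.
Variables (R : comPzRingType) (R_noeth : noetherian R).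
Variables (M : lmodType R) (M_max : maximum_condition M).
Variables (N : set M) (N_sub : is_submodule N) (y : R).
Hypotheses (y_jac : forall r, jacobson_radical R (r * y))
  (y_sat : forall m, N (y *: (y *: m)) -> N (y *: m)).

(** The intersection D of all N + y^k M satisfies D = N + yD by [y_sat]. The maximum condition on
    the submodules N + Rz replaces Nakayama's lemma: writing z = yz' modulo N, maximality gives z' =
    ryz' modulo N, and 1 - ry is a unit. *)
Lemma krull_intersection m :
  (forall k, (0 < k)%N -> add_mul N (y ^+ k) m) -> N m.
Proof.
pose D := [set m | forall k, (0 < k)%N -> add_mul N (y ^+ k) m].
have D_div n : D n -> exists2 z, D z & N (n - y *: z).
  (* The exponent [k.+2] leaves room to cancel one factor y by [y_sat], which shows that [y *: h 0]
     is congruent to [y ^+ k.+1 *: h k]. *)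
  move=> Dn; have /choice[h hP] k : exists h, N (n - y ^+ k.+2 *: h).
    by have [//|h] := Dn k.+2; exists h.
  exists (y *: h 0%N); last by rewrite scalerA -expr2; apply: hP.
  case=> // k _; exists (h k); apply: submodB_sym => //.
  rewrite exprS -scalerA -scalerBr; apply: y_sat.
  rewrite !scalerBr !scalerA -expr2 -exprD.
  by apply: (submod_trans N_sub) (hP 0%N); apply: submodB_sym => //; apply: hP.
move=> Dm; apply: contrapT => nNm.
have [||_ [z [Dz nNz ->]] maxL] := M_max
  (F := [set L | exists z, [/\ D z, ~ N z & L = cyclic_ext N z]]).
- by exists (cyclic_ext N m); exists m.
- by move=> _ [z [_ _ ->]]; apply: cyclic_ext_sub.
have [z' Dz' Nzz'] := D_div z Dz.
have nNz' : ~ N z'.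
  by move=> Nz'; apply: nNz; apply: (submod_congr N_sub Nzz'); apply: submodZ.
have [||r Nr] := maxL (cyclic_ext N z') _ _ z' (cyclic_ext_mem _ N_sub).
- by exists z'.
- move=> x [r Nr]; exists (r * y); rewrite -scalerA.
  by apply: (submod_trans N_sub Nr); rewrite -scalerBr; apply: submodZ.
have [v v1] := jacobson_unit R_noeth (y_jac r).
apply: nNz'; rewrite -[z']scale1r -v1 -scalerA; apply: submodZ => //.
rewrite scalerBl scale1r -scalerA; apply: (submod_trans N_sub Nr).
by rewrite -scalerBr; apply: submodZ.
Qed.

End KrullIntersection.

Section MultiplesOfModule.
Variables (R : comPzRingType) (M : lmodType R).
Implicit Types (S : set R).

Definition ideal_span S : set M := ideal_mul M (ideal_gen S).

Lemma ideal_span_sub S : is_submodule (ideal_span S).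
Proof. exact: submodule_gen_sub. Qed.

Lemma ideal_span_mem S r m : ideal_gen S r -> ideal_span S (r *: m).
Proof. by move=> Sr; apply: sub_submodule_gen; exists r; exists m. Qed.

Lemma ideal_span_min S (N : set M) : is_submodule N ->
  (forall r, S r -> forall m, N (r *: m)) -> ideal_span S `<=` N.
Proof.
move=> sN SN; apply: submodule_gen_min => // _ [r [m Sr ->]].
move: r Sr m; apply: ideal_gen_min => //; apply/idealP; split=> /=.
- by move=> m; rewrite scale0r; apply: submod0.
- by move=> r s Nr Ns m; rewrite scalerDl; apply: submodD.
- by move=> r s Ns m; rewrite -scalerA; apply: submodZ.
Qed.

Lemma ideal_spanS S S' : S `<=` S' -> ideal_span S `<=` ideal_span S'.
Proof.
move=> SS'; apply: ideal_span_min (ideal_span_sub _) _ => r /SS' S'r m.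
by apply: ideal_span_mem; apply: sub_ideal_gen.
Qed.

Lemma ideal_span_set0 : ideal_span set0 = [set 0].
Proof.
apply/seteqP; split; first exact: ideal_span_min (submod_set0 M) _.
by move=> _ ->; apply: submod0 (ideal_span_sub _).
Qed.

Lemma ideal_span_setU1 S y : ideal_span (y |` S) = add_mul (ideal_span S) y.
Proof.
have sS := ideal_span_sub S; have sS' := ideal_span_sub (y |` S).
apply/seteqP; split.
  apply: ideal_span_min => [|r [->|Sr] m]; first exact: add_mul_sub.
    exact: add_mul_mem.
  by apply: sub_add_mul; apply: ideal_span_mem; apply: sub_ideal_gen.
apply: add_mul_min => // [|m]; first by apply: ideal_spanS => r Sr; right.
by apply: ideal_span_mem; apply: sub_ideal_gen; left.
Qed.

End MultiplesOfModule.

Arguments ideal_span {R} M S.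

(** * Koszul complexes *)

Section KoszulLinearity.
Variables (R : comPzRingType) (M : lmodType R) (s : nat) (x : 'I_s -> R).
Implicit Types (f g : koszul M s) (u v w k : nat).

Lemma koszul_diffD f g : koszul_diff x (f + g) = koszul_diff x f + koszul_diff x g.
Proof.
apply/ffunP => I; rewrite !ffunE -big_split; apply: eq_bigr => j _.
by rewrite ffunE scalerDr.
Qed.

Lemma koszul_diffZ r f : koszul_diff x (r *: f) = r *: koszul_diff x f.
Proof.
apply/ffunP => I; rewrite !ffunE scaler_sumr; apply: eq_bigr => j _.
by rewrite ffunE !scalerA mulrC.
Qed.

Lemma koszul_diff0 : koszul_diff x 0 = 0 :> koszul M s.
Proof. by rewrite -(scale0r (0 : koszul M s)) koszul_diffZ !scale0r. Qed.

Lemma koszul_diffN f : koszul_diff x (- f) = - koszul_diff x f.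
Proof. by rewrite -scaleN1r koszul_diffZ scaleN1r. Qed.

Lemma koszul_diffB f g : koszul_diff x (f - g) = koszul_diff x f - koszul_diff x g.
Proof. by rewrite koszul_diffD koszul_diffN. Qed.

Lemma koszul_transD u v f g :
  koszul_trans x u v (f + g) = koszul_trans x u v f + koszul_trans x u v g.
Proof. by apply/ffunP => I; rewrite !ffunE scalerDr. Qed.

Lemma koszul_transZ u v r f :
  koszul_trans x u v (r *: f) = r *: koszul_trans x u v f.
Proof. by apply/ffunP => I; rewrite !ffunE !scalerA mulrC. Qed.

Lemma koszul_trans0 u v : koszul_trans x u v 0 = 0 :> koszul M s.
Proof. by rewrite -(scale0r (0 : koszul M s)) koszul_transZ !scale0r. Qed.

Lemma koszul_transN u v f : koszul_trans x u v (- f) = - koszul_trans x u v f.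
Proof. by rewrite -scaleN1r koszul_transZ scaleN1r. Qed.

Lemma koszul_transB u v f g :
  koszul_trans x u v (f - g) = koszul_trans x u v f - koszul_trans x u v g.
Proof. by rewrite koszul_transD koszul_transN. Qed.

Lemma koszul_trans_id u f : koszul_trans x u u f = f.
Proof.
by apply/ffunP => I; rewrite ffunE big1 ?scale1r // => j _; rewrite subnn expr0.
Qed.

Lemma koszul_trans_trans u v w f : (u <= v)%N -> (v <= w)%N ->
  koszul_trans x v w (koszul_trans x u v f) = koszul_trans x u w f.
Proof.
move=> le_uv le_vw; apply/ffunP => I; rewrite !ffunE scalerA -big_split /=.
congr (_ *: _); apply: eq_bigr => j _; rewrite -exprD; congr (_ ^+ _); lia.
Qed.

(** At I, the factor [x j ^+ (v - u)] that the transition lacks on [j |: I] is what turns [x j ^+ u]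
    into [x j ^+ v]. *)
Lemma koszul_diff_trans u v f : (u <= v)%N ->
  koszul_diff (powers x v) (koszul_trans x u v f) =
  koszul_trans x u v (koszul_diff (powers x u) f).
Proof.
move=> le_uv; apply/ffunP => I; rewrite !ffunE scaler_sumr; apply: eq_bigr => j jI.
rewrite ffunE !scalerA; congr (_ *: _).
rewrite [\prod_(i < s | i \notin I) _](bigD1 j) //= /powers.
rewrite [\prod_(i < s | i \notin (j |: I)%SET) _](eq_bigl
  (fun i => (i \notin I) && (i != j))); last first.
  by move=> i; rewrite !inE negb_or andbC.
by rewrite -{1}(subnK le_uv) exprD; ring.
Qed.

Lemma koszul_chains_sub p : is_submodule (koszul_chains p : set (koszul M s)).
Proof.
apply/submoduleP; split=> [J _|f g fp gp J nJ|r f fp J nJ]; first by rewrite ffunE.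
  by rewrite ffunE fp // gp // addr0.
by rewrite ffunE fp // scaler0.
Qed.

Lemma koszul_chains_trans p u v f :
  koszul_chains p f -> koszul_chains p (koszul_trans x u v f).
Proof. by move=> fp J nJ; rewrite ffunE fp ?scaler0. Qed.

Lemma koszul_chains_diff p f :
  koszul_chains (p + 1) f -> koszul_chains p (koszul_diff x f).
Proof.
move=> fp J nJ; rewrite ffunE big1 // => j jJ.
rewrite fp ?scaler0 // cardsU1 jJ; apply: contraNN nJ; lia.
Qed.

End KoszulLinearity.

(** * The Koszul complex as a mapping cone *)

Section Insertion.
Variables (R : comPzRingType) (M : lmodType R) (n : nat) (h : 'I_n.+1).
Implicit Types (p : int) (x : 'I_n.+1 -> R) (f : koszul M n.+1) (e g : koszul M n).
Implicit Types (I : {set 'I_n}) (J : {set 'I_n.+1}).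

Definition insert_sign J : nat := #|[set k in J | (k < h)%N]%SET|.

(* Splitting off the index h makes K(x) the mapping cone of x_h on the Koszul
   complex of the remaining elements; the sign in koszul_in makes its
   differential independent of the position of h. *)
Definition koszul_out f : koszul M n := [ffun I : {set 'I_n} => f (lift h @: I)%SET].

Definition koszul_in f : koszul M n :=
  [ffun I : {set 'I_n} =>
     ((-1) ^+ insert_sign (lift h @: I)%SET) *: f (h |: lift h @: I)%SET].

Definition koszul_glue e g : koszul M n.+1 :=
  [ffun J : {set 'I_n.+1} =>
     if h \in J then ((-1) ^+ insert_sign J) *: g (lift h @^-1: J)%SET
     else e (lift h @^-1: J)%SET].

Lemma lift_preimK I : (lift h @^-1: (lift h @: I) = I)%SET.
Proof. by apply/setP => i; rewrite inE mem_imset //; apply: lift_inj. Qed.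

Lemma lift_notin I : h \notin (lift h @: I)%SET.
Proof. by apply/imsetP => -[i _ /eqP]; rewrite (negPf (neq_lift h i)). Qed.

Lemma lift_imset_preim J : (lift h @: (lift h @^-1: J) = J :\ h)%SET.
Proof.
apply/setP => j; rewrite !inE; case: (unliftP h j) => [i|] ->.
  by rewrite mem_imset; [rewrite inE eq_sym neq_lift | apply: lift_inj].
by rewrite eqxx (negPf (lift_notin _)).
Qed.

Lemma lift_preimU1K I : (lift h @^-1: (h |: lift h @: I) = I)%SET.
Proof.
apply/setP => i; rewrite !inE mem_imset; last exact: lift_inj.
by rewrite eq_sym (negPf (neq_lift h i)).
Qed.

Lemma insert_signU1 J : insert_sign (h |: J) = insert_sign J.
Proof.
apply: eq_card => k; rewrite !inE; case: eqP => // ->.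
by rewrite ltnn !andbF.
Qed.

Lemma koszul_out_glue e g : koszul_out (koszul_glue e g) = e.
Proof.
by apply/ffunP => I; rewrite !ffunE (negPf (lift_notin I)) lift_preimK.
Qed.

Lemma scale_signrMK k (v : M) : ((-1) ^+ k : R) *: (((-1) ^+ k : R) *: v) = v.
Proof. by rewrite scalerA -exprMn mulrNN mulr1 expr1n scale1r. Qed.

Lemma koszul_in_glue e g : koszul_in (koszul_glue e g) = g.
Proof.
apply/ffunP => I; rewrite !ffunE setU11 insert_signU1 scale_signrMK.
by rewrite lift_preimU1K.
Qed.

(** Identities in K(x) are checked below on the two parts of the cone separately. *)
Lemma koszul_split_inj f f' :
  koszul_out f = koszul_out f' -> koszul_in f = koszul_in f' -> f = f'.
Proof.
move=> eq_out eq_in; apply/ffunP => J.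
have := congr1 (fun e : koszul M n => e (lift h @^-1: J)%SET) eq_in.
have := congr1 (fun e : koszul M n => e (lift h @^-1: J)%SET) eq_out.
rewrite !ffunE lift_imset_preim; have [hJ|hJ] := boolP (h \in J).
  move=> _ /(congr1 (fun m => ((-1) ^+ insert_sign (J :\ h)%SET : R) *: m)).
  by rewrite !scale_signrMK finset.setD1K.
suff -> : (J :\ h = J)%SET by [].
by apply/setP => k; rewrite !inE; case: eqP => // ->; rewrite (negPf hJ).
Qed.

Lemma koszul_outD f f' : koszul_out (f + f') = koszul_out f + koszul_out f'.
Proof. by apply/ffunP => I; rewrite !ffunE. Qed.

Lemma koszul_inD f f' : koszul_in (f + f') = koszul_in f + koszul_in f'.
Proof. by apply/ffunP => I; rewrite !ffunE scalerDr. Qed.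

Lemma koszul_outZ r f : koszul_out (r *: f) = r *: koszul_out f.
Proof. by apply/ffunP => I; rewrite !ffunE. Qed.

Lemma koszul_inZ r f : koszul_in (r *: f) = r *: koszul_in f.
Proof. by apply/ffunP => I; rewrite !ffunE !scalerA mulrC. Qed.

Lemma koszul_outN f : koszul_out (- f) = - koszul_out f.
Proof. by rewrite -scaleN1r koszul_outZ scaleN1r. Qed.

Lemma koszul_inN f : koszul_in (- f) = - koszul_in f.
Proof. by rewrite -scaleN1r koszul_inZ scaleN1r. Qed.

Lemma koszul_out0 : koszul_out 0 = 0.
Proof. by apply/ffunP => I; rewrite !ffunE. Qed.

Lemma koszul_in0 : koszul_in 0 = 0.
Proof. by apply/ffunP => I; rewrite !ffunE scaler0. Qed.

Lemma ltn_lift (i j : 'I_n) : (lift h i < lift h j)%N = (i < j)%N.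
Proof. by rewrite /= /bump; lia. Qed.

Lemma card_lift_below I (j : 'I_n) :
  #|[set k in lift h @: I | (k < lift h j)%N]%SET| = #|[set k in I | (k < j)%N]%SET|.
Proof.
rewrite -(card_imset _ (@lift_inj _ h)); apply: eq_card => k.
rewrite !inE; apply/andP/imsetP => [[/imsetP[i iI ->]]|[i]].
  by rewrite ltn_lift => ij; exists i; rewrite // inE iI.
by rewrite inE => /andP[iI ij] ->; rewrite ltn_lift imset_f.
Qed.

Lemma koszul_out_diff x f :
  koszul_out (koszul_diff x f) =
  koszul_diff (x \o lift h) (koszul_out f) + x h *: koszul_in f.
Proof.
apply/ffunP => I; rewrite !ffunE (bigD1_ord h) ?lift_notin //= addrC scalerA mulrC.
congr (_ + _); apply: eq_big => [j|j jI]; first by rewrite mem_imset //; apply: lift_inj.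
by rewrite card_lift_below ffunE imsetU1.
Qed.

(** Exactly one of the two signs changes when both h and [lift h j] are present: the sign of the
    differential if h comes first, [insert_sign] if [lift h j] comes first. This yields the global
    minus sign. *)
Lemma koszul_in_diff x f :
  koszul_in (koszul_diff x f) = - koszul_diff (x \o lift h) (koszul_in f).
Proof.
apply/ffunP => I; rewrite !ffunE -sumrN scaler_sumr big_mkcond (bigD1_ord h) //=.
rewrite setU11 add0r [RHS]big_mkcond; apply: eq_bigr => j _.
have -> : (lift h j \notin (h |: lift h @: I)%SET) = (j \notin I).
  by rewrite !inE eq_sym (negPf (neq_lift h j)) mem_imset //; apply: lift_inj.
case: ifP => // jI; rewrite ffunE imsetU1 finset.setUCA !scalerA -scaleNr; congr (_ *: _).
have -> : #|[set k in h |: lift h @: I | (k < lift h j)%N]%SET| =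
          ((h < lift h j)%N + #|[set k in I | (k < j)%N]%SET|)%N.
  rewrite -card_lift_below; case: ltnP => hj.
    rewrite (_ : [set _ in _ | _]%SET =
                 (h |: [set k in lift h @: I | (k < lift h j)%N])%SET).
      by rewrite cardsU1 inE (negPf (lift_notin I)).
    by apply/setP => k; rewrite !inE; case: eqP => // ->; rewrite hj.
  apply: eq_card => k; rewrite !inE; case: eqP => // ->.
  by rewrite (negPf (lift_notin I)) ltnNge hj.
have -> : insert_sign (lift h j |: lift h @: I)%SET =
          ((lift h j < h)%N + insert_sign (lift h @: I))%N.
  rewrite /insert_sign; case: ltnP => hj.
    rewrite (_ : [set _ in _ | _]%SET =
                 (lift h j |: [set k in lift h @: I | (k < h)%N])%SET).
      by rewrite cardsU1 inE (mem_imset _ _ (@lift_inj _ h)) (negPf jI).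
    by apply/setP => k; rewrite !inE; case: eqP => // ->; rewrite hj.
  apply: eq_card => k; rewrite !inE; case: eqP => // ->.
  by rewrite (mem_imset _ _ (@lift_inj _ h)) (negPf jI) ltnNge hj.
case: (ltngtP h (lift h j)) => [_|_|/val_inj/eqP]; last by rewrite (negPf (neq_lift h j)).
  by rewrite /= add0n exprD expr1; ring.
by rewrite /= add0n exprD expr1; ring.
Qed.

(** Only the part without h picks up powers of [x h]; a cycle there becomes a boundary in the limit
    once such a power is null-homotopic. *)
Lemma koszul_out_trans x u v f :
  koszul_out (koszul_trans x u v f) =
  x h ^+ (v - u) *: koszul_trans (x \o lift h) u v (koszul_out f).
Proof.
apply/ffunP => I; rewrite !ffunE (bigD1_ord h) ?lift_notin //= scalerA.
congr (_ * _ *: _); apply: eq_bigl => j.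
by rewrite mem_imset //; apply: lift_inj.
Qed.

Lemma koszul_in_trans x u v f :
  koszul_in (koszul_trans x u v f) = koszul_trans (x \o lift h) u v (koszul_in f).
Proof.
apply/ffunP => I; rewrite !ffunE !scalerA mulrC; congr (_ * _ *: _).
rewrite big_mkcond (bigD1_ord h) //= setU11 mul1r [RHS]big_mkcond.
apply: eq_bigr => j _; rewrite !inE eq_sym (negPf (neq_lift h j)) mem_imset //.
exact: lift_inj.
Qed.

Lemma card_lift I : #|(lift h @: I)%SET| = #|I|.
Proof. by rewrite card_imset //; apply: lift_inj. Qed.

Lemma koszul_chains_out p f : koszul_chains p f -> koszul_chains p (koszul_out f).
Proof. by move=> fp I nI; rewrite ffunE fp // card_lift. Qed.

Lemma koszul_chains_in p f : koszul_chains (p + 1) f -> koszul_chains p (koszul_in f).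
Proof.
move=> fp I nI; rewrite ffunE fp ?scaler0 // cardsU1 lift_notin card_lift.
by apply: contraNN nI; lia.
Qed.

Lemma koszul_chains_glue p e g :
  koszul_chains (p + 1) e -> koszul_chains p g -> koszul_chains (p + 1) (koszul_glue e g).
Proof.
move=> ep gp J; rewrite ffunE (cardsD1 h) -lift_imset_preim card_lift.
case: ifP => hJ nJ; last by rewrite ep.
by rewrite gp ?scaler0 //; apply: contraNN nJ; lia.
Qed.

End Insertion.

Lemma sub_telescope (V : zmodType) (A B C D E : V) :
  A - B - (C - D) + (B - D - E) = A - C - E.
Proof.
have -> : A - B - (C - D) = (A - C) - (B - D) by rewrite !opprD !opprK addrACA.
by rewrite addrA subrK.
Qed.

(** Induction on the cone: the two cross terms carrying [x ord0] have opposite signs and cancel. *)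
Lemma koszul_diffK (R : comPzRingType) (M : lmodType R) n (x : 'I_n -> R)
    (f : koszul M n) : koszul_diff x (koszul_diff x f) = 0.
Proof.
elim: n x f => [|n IHn] x f; first by apply/ffunP => I; rewrite !ffunE big_ord0.
apply: (@koszul_split_inj _ _ _ ord0).
  rewrite koszul_out0 !koszul_out_diff koszul_in_diff koszul_diffD koszul_diffZ IHn.
  by rewrite add0r scalerN subrr.
by rewrite koszul_in0 !koszul_in_diff koszul_diffN IHn !oppr0.
Qed.

Section KoszulValued.
Variables (R : comPzRingType) (M : lmodType R) (N : set M) (N_sub : is_submodule N).

Definition koszul_valued s : set (koszul M s) := [set f | forall J, N (f J)].

Lemma koszul_valued_sub s : is_submodule (koszul_valued (s := s)).
Proof.
apply/submoduleP; split=> [J|f g Nf Ng J|r f Nf J]; rewrite ffunE.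
- exact: submod0.
- by apply: submodD; [| apply: Nf | apply: Ng].
- by apply: submodZ => //; apply: Nf.
Qed.

Lemma koszul_valued_diff s (x : 'I_s -> R) f :
  koszul_valued f -> koszul_valued (koszul_diff x f).
Proof.
move=> Nf I; rewrite ffunE; apply: submod_sum => // j _.
by apply: submodZ => //; apply: Nf.
Qed.

Lemma koszul_valued_trans s (x : 'I_s -> R) u v f :
  koszul_valued f -> koszul_valued (koszul_trans x u v f).
Proof. by move=> Nf I; rewrite ffunE; apply: submodZ => //; apply: Nf. Qed.

(* Multiplication by an element of <x> is null-homotopic on K(x). *)
Lemma koszul_null_homotopy s (x : 'I_s -> R) y : ideal_gen (range x) y ->
  forall p (z : koszul M s), koszul_chains p z -> koszul_valued (koszul_diff x z) ->
  exists2 w, koszul_chains (p + 1) w & koszul_valued (koszul_diff x w - y *: z).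
Proof.
have sK := koszul_valued_sub s.
have sC p : is_submodule (koszul_chains p : set (koszul M s)) := koszul_chains_sub _ _ p.
move: y; apply: ideal_gen_min.
  apply/idealP; split=> /= [p z zp dz|r r' hr hr' p z zp dz|r r' hr' p z zp dz].
  - exists 0; first exact: (submod0 (sC _)).
    by rewrite koszul_diff0 scale0r subrr; apply: (submod0 sK).
  - have [w wp dw] := hr p z zp dz; have [w' w'p dw'] := hr' p z zp dz.
    exists (w + w'); first exact: (submodD (sC _)).
    by rewrite koszul_diffD scalerDl opprD addrACA; apply: (submodD sK).
  - have [w wp dw] := hr' p z zp dz; exists (r *: w); first exact: (submodZ (sC _)).
    by rewrite koszul_diffZ -scalerA -scalerBr; apply: (submodZ sK).
move=> _ [j _ <-] p z zp dz; case: s j x z sK sC zp dz => [[]//|n] j x z sK sC zp dz.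
(* The homotopy for the generator [x j] is exterior multiplication by the basis element of index j,
   up to sign; the error is minus the part of [koszul_diff x z] without j, placed at j. *)
exists (koszul_glue j 0 (koszul_out j z)).
  apply: koszul_chains_glue; last exact: koszul_chains_out.
  exact: (submod0 (koszul_chains_sub _ _ _)).
rewrite [X in koszul_valued X](_ : _ = koszul_glue j 0 (- koszul_out j (koszul_diff x z))).
  move=> J; rewrite ffunE; case: ifP => _; last by rewrite ffunE; apply: submod0.
  by apply: submodZ => //; rewrite ffunE; apply: submodN => //; rewrite ffunE; apply: dz.
apply: (@koszul_split_inj _ _ _ j).
  rewrite koszul_outD koszul_outN koszul_outZ koszul_out_diff !koszul_out_glue.
  by rewrite koszul_in_glue koszul_diff0 add0r subrr.
rewrite koszul_inD koszul_inN koszul_inZ koszul_in_diff !koszul_in_glue.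
by rewrite koszul_out_diff opprD.
Qed.

End KoszulValued.

Section ColimitSurjectivity.
Variables (R : comPzRingType) (M : lmodType R).
Implicit Types (N : set M) (p : int).

(* Surjectivity of the map from the homology of K(x, M/N) in degree p to the
   direct limit of the homology of the K(x^u, M/N), expressed on M. *)
Definition colim_surjective N s (x : 'I_s -> R) p : Prop :=
  forall u (f : koszul M s), (0 < u)%N -> koszul_chains p f ->
    koszul_valued N (koszul_diff (powers x u) f) ->
  exists z k g, [/\ koszul_chains p z, koszul_valued N (koszul_diff x z),
    (u <= k)%N, koszul_chains (p + 1) g &
    koszul_valued N (koszul_trans x 1 k z - koszul_trans x u k f
                       - koszul_diff (powers x k) g)].

Lemma koszul_valued_set0 s (f : koszul M s) : koszul_valued [set 0] f <-> f = 0.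
Proof.
split=> [f0|f0 J]; last by rewrite f0 ffunE.
by apply/ffunP => J; rewrite ffunE; apply: f0.
Qed.

(** Homological degree s is cohomological degree 0: a chain is one element at the full index set,
    transitions act there as the identity, and there are no boundaries. A torsion element m is a
    germ at a high level, and a preimage at level 1 is congruent to m and killed by every [x j]. *)
Lemma colim_surjective_power_torsion N s (x : 'I_s -> R) m :
  is_submodule N -> colim_surjective N x s ->
  (forall j, exists u, N (x j ^+ u *: m)) -> forall j, N (x j *: m).
Proof.
move=> sN surj /choice[e eP] j.
(* The sum bounds every [e i], and the successor makes the level positive. *)
pose u := (\sum_(i < s) e i).+1.
have uP i : N (x i ^+ u *: m).
  have le_eu : (e i <= u)%N by rewrite /u (bigD1 i) //= ltnW // ltnS leq_addr.
  by rewrite -(subnK le_eu) exprD -scalerA; apply: submodZ.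
pose f : koszul M s := [ffun J : {set 'I_s} => if J == [set: 'I_s]%SET then m else 0].
have fs : koszul_chains s f.
  by move=> J; rewrite ffunE; case: (J =P _) => // ->; rewrite cardsT card_ord eqxx.
have df : koszul_valued N (koszul_diff (powers x u) f).
  move=> I; rewrite ffunE; apply: submod_sum => // i _; rewrite ffunE.
  case: ifP => _; last by rewrite scaler0; apply: submod0.
  by rewrite -scalerA; apply: submodZ => //; apply: uP.
have [z [k [g [zs dz _ gs]]]] := surj u f isT fs df.
have -> : koszul_diff (powers x k) g = 0.
  suff -> : g = 0 by apply: koszul_diff0.
  apply/ffunP => J; rewrite ffunE; apply: gs.
  have : (#|J| <= s)%N by rewrite (leq_trans (max_card _)) // card_ord.
  by lia.
move=> /(_ [set: 'I_s]%SET); rewrite !ffunE eqxx subr0.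
rewrite !big1 ?scale1r => [Nzm|i|i]; rewrite ?inE //.
(* At the complement of j the differential has the single term [x j] times the value at the full
   set. *)
have := dz (~: [set j])%SET; rewrite ffunE (big_pred1 j) => [|i]; last by rewrite !inE negbK.
rewrite (_ : (j |: ~: [set j])%SET = [set: 'I_s]%SET); last first.
  by apply/setP => i; rewrite !inE orbN.
set c := #|_|; move=> /(submodZ sN ((-1) ^+ c)).
rewrite -[((-1) ^+ c * x j) *: _]scalerA scale_signrMK => Nxz.
apply: (submod_congr sN _ Nxz); rewrite -scalerBr; apply: submodZ => //.
exact: submodB_sym.
Qed.

(** The lift is chosen component by component and set to 0 outside degree q, so that it remains a
    chain of that degree. *)
Lemma koszul_valued_add_mul N s y q (f : koszul M s) : is_submodule N ->
  koszul_chains q f -> koszul_valued (add_mul N y) f ->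
  exists2 e, koszul_chains q e & koszul_valued N (f - y *: e).
Proof.
move=> sN fq /choice[e eP].
exists [ffun J : {set 'I_s} => if #|J|%:Z == q then e J else 0].
  by move=> J /negPf nJ; rewrite ffunE nJ.
move=> J; rewrite !ffunE; case: eqP => [_|/eqP nJ]; first exact: eP.
by rewrite fq // scaler0 subr0; apply: submod0.
Qed.

(* The long exact sequences of 0 -> M/(N : y) -> M/N -> M/(N + yM) -> 0 in one
   chase: w lifts to K(x) the connecting image of a germ f over N + yM. *)
Lemma colim_surjective_add_mul N s (x : 'I_s -> R) y p :
  is_submodule N -> ideal_gen (range x) y -> (p <= s)%R ->
  (forall m, N (y *: m) -> forall j, N (x j *: m)) ->
  colim_surjective N x p -> colim_surjective N x (p - 1) ->
  colim_surjective (add_mul N y) x p.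
Proof.
move=> sN xy le_ps y_reg surj surj' u f u_gt0 fp df.
have sK := koszul_valued_sub sN s; have sN' := add_mul_sub y sN.
have sK' := koszul_valued_sub sN' s.
have sC q : is_submodule (koszul_chains q : set (koszul M s)) := koszul_chains_sub _ _ q.
have KK' g : koszul_valued N g -> koszul_valued (add_mul N y) (g : koszul M s).
  by move=> Ng J; apply: sub_add_mul.
have yK' (g : koszul M s) : koszul_valued (add_mul N y) (y *: g).
  by move=> J; rewrite ffunE; apply: add_mul_mem.
have dp q v (g : koszul M s) : koszul_chains q g ->
    koszul_chains (q - 1) (koszul_diff (powers x v) g).
  by move=> gq; apply: koszul_chains_diff; rewrite subrK.
(* e represents the connecting image of f: the boundary of f is [y *: e] modulo N. *)
have [e ep de] := koszul_valued_add_mul sN (dp _ _ _ fp) df.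
(* The boundary of e is killed by y modulo N, hence by every [x j]. Passing from level u to [u.+1]
   multiplies the component at J by all [x j] with j outside J; J is not the full set, having p - 2
   elements, so the result lies in N. *)
have dTe : koszul_valued N (koszul_diff (powers x u.+1) (koszul_trans x u u.+1 e)).
  rewrite koszul_diff_trans // => J; rewrite ffunE.
  have dep := dp _ u _ ep.
  have [nJ|/eqP J_p] := boolP (#|J|%:Z != p - 1 - 1).
    by rewrite dep // scaler0; apply: submod0.
  have [j jJ] : exists j, j \notin J.
    apply/existsP; rewrite -negb_forall; apply/negP => /forallP JT.
    have : #|J| = s by rewrite (eq_card (B := 'I_s)) ?card_ord.
    by move=> Js; rewrite Js in J_p; lia.
  rewrite (bigD1 j) //= mulrC subSnn expr1 -scalerA; apply: submodZ => //.
  apply: y_reg.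
  have /(submodN sK) := koszul_valued_diff sN (powers x u) de.
  by rewrite koszul_diffB koszul_diffK koszul_diffZ sub0r opprK => /(_ J); rewrite ffunE.
have [z' [k [g [z'p dz' le_uk gp Tz']]]] :=
  surj' _ _ (ltn0Sn u) (koszul_chains_trans x u u.+1 ep) dTe.
rewrite koszul_trans_trans ?(ltnW le_uk) // in Tz'.
have le_uk' := ltnW le_uk.
rewrite subrK in gp.
have [w wp dw] := koszul_null_homotopy sN xy z'p dz'; rewrite subrK in wp.
(* Both w and f have boundaries divisible by y modulo N, with quotients z' and e; their germs differ
   by the boundary of g, so v is a cycle modulo N. *)
pose v := koszul_trans x 1 k w - koszul_trans x u k f - y *: g.
have vp : koszul_chains p v.
  apply: (submodB (sC _)); last exact: (submodZ (sC _)).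
  by apply: (submodB (sC _)); apply: koszul_chains_trans.
have le_1k : (1 <= k)%N by lia.
have dv : koszul_valued N (koszul_diff (powers x k) v).
  rewrite /v !koszul_diffB koszul_diffZ !koszul_diff_trans //.
  have := koszul_valued_trans sN x 1 k dw; have := koszul_valued_trans sN x u k de.
  rewrite !koszul_transB !koszul_transZ => /(submodN sK) Te Tw.
  have := submodD sK (submodD sK Tw Te) (submodZ sK y Tz').
  by rewrite !scalerBr sub_telescope.
have [z0 [l [g' [z0p dz0 le_kl g'p Tz0]]]] := surj _ _ le_1k vp dv.
(* Since z0 represents v, the germ of [w - z0] is that of f up to a boundary and the term
   [y *: koszul_trans x k l g], which vanishes modulo yM. *)
exists (w - z0), l, (- g'); split.
- exact: (submodB (sC _)).
- rewrite koszul_diffB; apply: (submodB sK'); last exact: KK'.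
  by apply: (submod_congr sK' (KK' _ dw)).
- exact: leq_trans le_kl.
- exact: (submodN (sC _)).
rewrite koszul_diffN opprK koszul_transB.
rewrite /v !koszul_transB koszul_transZ !koszul_trans_trans // in Tz0.
apply: (submod_congr sK' _ (submodN sK' (KK' _ Tz0))).
move: (yK' (koszul_trans x k l g)); congr (koszul_valued _ _).
rewrite opprK addrACA subrr addr0 [_ - _ - koszul_trans x u l f]addrAC.
by rewrite addrA subrK opprB addrC subrK.
Qed.

End ColimitSurjectivity.

(** * Independence of the generating set *)

Section Germs.
Variables (R : comPzRingType) (M : lmodType R) (s : nat) (x : 'I_s -> R) (p : int).
Implicit Types (f g h : nat * koszul M s).

Lemma koszul_boundaries_sub (y : 'I_s -> R) :
  is_submodule (koszul_boundaries y p : set (koszul M s)).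
Proof.
have sC := koszul_chains_sub M s (p + 1).
apply/submoduleP; split=> [|_ _ [g gp <-] [h hp <-]|r _ [g gp <-]].
- by exists 0; [apply: (submod0 sC) | apply: koszul_diff0].
- by exists (g + h); [apply: (submodD sC) | apply: koszul_diffD].
- by exists (r *: g); [apply: (submodZ sC) | apply: koszul_diffZ].
Qed.

Lemma koszul_boundaries_trans u v (z : koszul M s) : (u <= v)%N ->
  koszul_boundaries (powers x u) p z ->
  koszul_boundaries (powers x v) p (koszul_trans x u v z).
Proof.
move=> le_uv [g gp <-]; exists (koszul_trans x u v g); last exact: koszul_diff_trans.
exact: koszul_chains_trans.
Qed.

Lemma germ_eq_refl g : germ_eq x p g g.
Proof.
exists g.1; split=> //; by rewrite subrr; apply: (submod0 (koszul_boundaries_sub _)).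
Qed.

Lemma germ_eq_sym g h : germ_eq x p g h -> germ_eq x p h g.
Proof.
move=> [k [le_gk le_hk b]]; exists k; split=> //.
exact: (submodB_sym (koszul_boundaries_sub _)).
Qed.

Lemma germ_eq_trans f g h : germ_eq x p f g -> germ_eq x p g h -> germ_eq x p f h.
Proof.
move=> [k [le_fk le_gk b]] [l [le_gl le_hl b']].
have [le_kkl le_lkl] := (leq_addr l k, leq_addl k l).
exists (k + l)%N; split; try lia.
have := koszul_boundaries_trans le_kkl b; have := koszul_boundaries_trans le_lkl b'.
rewrite !koszul_transB !koszul_trans_trans // => b2 b1.
exact: (submod_trans (koszul_boundaries_sub _)) b1 b2.
Qed.

Lemma germ_class_eq g h : germ_eq x p g h -> germ_class x p g = germ_class x p h.
Proof.
move=> gh; apply/seteqP; split=> f [fp ef]; split=> //.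
  exact: germ_eq_trans (germ_eq_sym gh) ef.
exact: germ_eq_trans gh ef.
Qed.

(** This unfolds equality of classes into equality of representatives in the limit; over N = 0,
    being valued in N means being zero. *)
Lemma to_koszul_colim_surjP :
  set_surj (@koszul_homology R M s x p) (@koszul_colim R M s x p) (to_koszul_colim x p)
  <-> colim_surjective ([set 0] : set M) x p.
Proof.
have sB y := koszul_boundaries_sub y.
split=> [surj u f u_gt0 fp /koszul_valued_set0 df|surj].
  have [|_ [z [zp dz] <-] zE] := surj (germ_class x p (u, f)); first by exists (u, f).
  have : germ_class x p (u, f) (1%N, z).
    rewrite -zE; exists z; first by split; [| rewrite subrr; apply: (submod0 (sB x))].
    by split; [split | apply: germ_eq_refl].
  move=> [_ /germ_eq_sym[k [/= _ le_uk [g gp gE]]]]; exists z, k, g; split=> //.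
    exact/koszul_valued_set0.
  by apply/koszul_valued_set0; rewrite -gE subrr.
move=> _ [[u f] [/= u_gt0 [fp df]] <-].
have [|z [k [g [zp /koszul_valued_set0 dz le_uk gp /koszul_valued_set0 gE]]]] :=
  surj u f u_gt0 fp; first exact/koszul_valued_set0.
have z_f : germ_eq x p (1%N, z) (u, f).
  exists k; split=> //=; first by lia.
  by exists g => //; apply/esym/eqP; rewrite -subr_eq0 gE.
exists (koszul_class x p z); first by exists z.
apply/seteqP; split=> [h [z' [[z'p dz'] z'z] hz']|h hf]; last first.
  exists z; first by split; [| rewrite subrr; apply: (submod0 (sB x))].
  by rewrite (germ_class_eq z_f).
rewrite -(germ_class_eq z_f).
rewrite (germ_class_eq (h := (1%N, z'))) //; apply: germ_eq_sym; exists 1%N; split=> //.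
by rewrite /= !koszul_trans_id.
Qed.

End Germs.

Section InsertElement.
Variables (R : comPzRingType) (M : lmodType R) (n : nat) (h : 'I_n.+1).
Variables (x : 'I_n.+1 -> R) (p : int).
Local Notation x' := (x \o lift h).
Hypothesis xh : ideal_gen (range x') (x h).

Let N0 : set M := [set 0].
Let sN0 : is_submodule N0 := submod_set0 M.

(** Some power of [x h] lies in the ideal generated by the u-th powers of the remaining elements,
    hence is null-homotopic on their Koszul complex. *)
Lemma inserted_power_homotopy u v : exists2 k, (v <= k)%N &
  forall q (z : koszul M n), koszul_chains q z -> koszul_diff (powers x' u) z = 0 ->
  exists2 w, koszul_chains (q + 1) w & koszul_diff (powers x' u) w = x h ^+ k *: z.
Proof.
have [k0 k0P] := ideal_gen_powers (fun=> u) xh.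
exists (k0 + v)%N; first exact: leq_addl.
move=> q z zq /(koszul_valued_set0 _).2 dz.
have [|w wq] := koszul_null_homotopy sN0 (y := x h ^+ (k0 + v)) _ zq dz.
  by apply: ideal_expS k0P; [apply: ideal_genP | apply: leq_addr].
by move=> /koszul_valued_set0/eqP; rewrite subr_eq0 => /eqP; exists w.
Qed.

Lemma powers_lift u : powers x u \o lift h = powers x' u.
Proof. by []. Qed.

(** A germ f' over the shorter sequence is the [koszul_in] part of a germ over x; a preimage of the
    latter is projected back by [koszul_in]. *)
Lemma colim_surjective_remove :
  colim_surjective N0 x (p + 1) -> colim_surjective N0 x' p.
Proof.
move=> surj u f' u_gt0 f'p /koszul_valued_set0 df'.
(* The same k is the exponent of [x h] that bounds f' and the level to which f' is moved, where the
   cone differential multiplies by exactly [x h ^+ k]. *)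
have [k le_uk /(_ _ _ f'p df')[w wp dw]] := inserted_power_homotopy u u.
pose g := koszul_trans x' u k f'.
have dg : koszul_diff (powers x' k) g = 0.
  by rewrite koszul_diff_trans // df' koszul_trans0.
pose f := koszul_glue h (- koszul_trans x' u k w) g.
have fp : koszul_chains (p + 1) f.
  apply: koszul_chains_glue; last exact: koszul_chains_trans.
  by apply: (submodN (koszul_chains_sub _ _ _)); apply: koszul_chains_trans.
have df : koszul_diff (powers x k) f = 0.
  apply: (@koszul_split_inj _ _ _ h).
    rewrite koszul_out_diff koszul_out_glue koszul_in_glue powers_lift koszul_diffN.
    by rewrite koszul_diff_trans // dw koszul_transZ addNr koszul_out0.
  by rewrite koszul_in_diff koszul_in_glue powers_lift dg oppr0 koszul_in0.
have [|||z [l [G [zp dz le_kl Gp GE]]]] := surj k f; rewrite ?df //.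
- by lia.
- exact/koszul_valued_set0.
move: dz GE => /koszul_valued_set0 dz /koszul_valued_set0 GE.
(* The sign of the last witness appears because [koszul_in] anticommutes with the differential. *)
exists (koszul_in h z), l, (- koszul_in h G); split.
- exact: (koszul_chains_in h).
- apply/koszul_valued_set0/eqP; rewrite -oppr_eq0; apply/eqP.
  by rewrite -[LHS](koszul_in_diff h) dz koszul_in0.
- exact: leq_trans le_kl.
- by apply: (submodN (koszul_chains_sub _ _ _)); apply: (koszul_chains_in h).
apply/koszul_valued_set0.
have := congr1 (koszul_in h) GE.
rewrite !koszul_inD !koszul_inN koszul_in_diff !koszul_in_trans koszul_in_glue.
by rewrite koszul_trans_trans // koszul_in0 koszul_diffN.
Qed.

(** The [koszul_in] part of f has a preimage z', which extends to a cycle z of K(x) since [x h] is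
    null-homotopic. After a correction by a boundary, the difference of germs has only a
    [koszul_out] part, and this becomes a boundary at a higher level. *)
Lemma colim_surjective_insert :
  colim_surjective N0 x' p -> colim_surjective N0 x (p + 1).
Proof.
move=> surj u f u_gt0 fp /koszul_valued_set0 df.
pose g := koszul_in h f.
have dg : koszul_diff (powers x' u) g = 0.
  apply/eqP; rewrite -oppr_eq0; apply/eqP.
  by rewrite -powers_lift -koszul_in_diff df koszul_in0.
have [||z' [k [G [z'p dz' le_uk Gp GE]]]] := surj u g u_gt0.
- exact: (koszul_chains_in h).
- exact/koszul_valued_set0.
have [w wp] := koszul_null_homotopy sN0 xh z'p dz'.
move=> /koszul_valued_set0/eqP; rewrite subr_eq0 => /eqP dw.
move: dz' GE => /koszul_valued_set0 dz' /koszul_valued_set0 GE.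
have le_1k : (1 <= k)%N by lia.
have sC := koszul_chains_sub M.
pose z := koszul_glue h (- w) z'; pose G' := koszul_glue h 0 (- G).
have zp : koszul_chains (p + 1) z.
  by apply: koszul_chains_glue => //; apply: (submodN (sC _ _)).
have dz : koszul_diff x z = 0.
  apply: (@koszul_split_inj _ _ _ h).
    rewrite koszul_out_diff koszul_out_glue koszul_in_glue koszul_diffN dw.
    by rewrite addNr koszul_out0.
  by rewrite koszul_in_diff koszul_in_glue dz' oppr0 koszul_in0.
have G'p : koszul_chains (p + 1 + 1) G'.
  by apply: koszul_chains_glue; [apply: (submod0 (sC _ _)) | apply: (submodN (sC _ _))].
pose E := koszul_trans x 1 k z - koszul_trans x u k f - koszul_diff (powers x k) G'.
have inE : koszul_in h E = 0.
  rewrite !koszul_inD !koszul_inN koszul_in_diff !koszul_in_trans !koszul_in_glue.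
  by rewrite koszul_diffN opprK; apply: GE.
have Ep : koszul_chains (p + 1) E.
  apply: (submodB (sC _ _)); last exact: koszul_chains_diff.
  by apply: (submodB (sC _ _)); apply: koszul_chains_trans.
have dE : koszul_diff (powers x k) E = 0.
  rewrite !koszul_diffB koszul_diffK !koszul_diff_trans //.
  by rewrite df [koszul_diff _ z]dz !koszul_trans0 !subr0.
have dout : koszul_diff (powers x' k) (koszul_out h E) = 0.
  have := congr1 (koszul_out h) dE.
  by rewrite koszul_out_diff inE scaler0 addr0 koszul_out0.
(* Moving up by [l0] levels multiplies the [koszul_out] part by [x h ^+ l0], which makes it a
   boundary. *)
have [l0 _ /(_ _ _ (koszul_chains_out h Ep) dout)[w2 w2p dw2]] :=
  inserted_power_homotopy k 0.
pose l := (k + l0)%N; have le_kl : (k <= l)%N := leq_addr _ _.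
pose W := koszul_glue h (koszul_trans x' k l w2) 0.
have Wp : koszul_chains (p + 1 + 1) W.
  by apply: koszul_chains_glue; [apply: koszul_chains_trans | apply: (submod0 (sC _ _))].
have TE : koszul_trans x k l E = koszul_diff (powers x l) W.
  apply: (@koszul_split_inj _ _ _ h).
    rewrite koszul_out_trans koszul_out_diff koszul_out_glue koszul_in_glue powers_lift.
    by rewrite scaler0 addr0 koszul_diff_trans // dw2 koszul_transZ /l addKn.
  by rewrite koszul_in_trans inE koszul_in_diff koszul_in_glue koszul_trans0 koszul_diff0 oppr0.
exists z, l, (koszul_trans x k l G' + W); split=> //.
- exact/koszul_valued_set0.
- exact: leq_trans le_kl.
- by apply: (submodD (sC _ _)) => //; apply: koszul_chains_trans.
apply/koszul_valued_set0; rewrite koszul_diffD -TE koszul_diff_trans //.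
by rewrite /E !koszul_transB !koszul_trans_trans // [X in _ - _ - X]addrC subrK subrr.
Qed.

End InsertElement.

Section GeneratorIndependence.
Variables (R : comPzRingType) (M : lmodType R).

(** Indexing by [nat] with a separate length lets list sizes be rewritten without casts between
    ordinals. *)
Definition lambda_surj_nat n (x : nat -> R) i :=
  lambda_surjective M (fun j : 'I_n => x j) i.

Lemma lambda_surjectiveP n (x : 'I_n -> R) i :
  lambda_surjective M x i <-> colim_surjective ([set 0] : set M) x (n%:Z - i%:Z).
Proof. exact: to_koszul_colim_surjP. Qed.

(** Insertion raises the length and the homological degree by one together, so the cohomological
    degree i is unchanged. *)
Lemma lambda_surjective_insert (l1 l2 : seq R) y i :
  ideal_gen [set r | r \in l1 ++ l2] y ->
  lambda_surj_nat (size (l1 ++ y :: l2)) (nth 0 (l1 ++ y :: l2)) i <->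
  lambda_surj_nat (size (l1 ++ l2)) (nth 0 (l1 ++ l2)) i.
Proof.
move=> yl; rewrite /lambda_surj_nat !size_cat /= addnS.
set n := (size l1 + size l2)%N.
have h_lt : (size l1 < n.+1)%N by rewrite ltnS leq_addr.
pose h := Ordinal h_lt; pose x (j : 'I_n.+1) := nth 0 (l1 ++ y :: l2) j.
have xE : x \o lift h = fun j : 'I_n => nth 0 (l1 ++ l2) j.
  apply/funext => j; rewrite /x /= /bump; case: leqP => [le_j|lt_j]; rewrite !nth_cat.
    have -> : (true + j < size l1)%N = false by rewrite ltnNge leqW.
    have -> : (j < size l1)%N = false by rewrite ltnNge le_j.
    by have -> : (true + j - size l1)%N = (j - size l1).+1 by apply: subSn.
  by rewrite add0n lt_j.
have xh : ideal_gen (range (x \o lift h)) (x h).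
  rewrite xE /x /= nth_cat ltnn subnn /=.
  apply: ideal_gen_min yl; first exact: ideal_genP.
  move=> r rl; apply: sub_ideal_gen; move: rl => /= /(nthP 0)[j]; rewrite size_cat => lt_jn <-.
  by exists (Ordinal lt_jn).
rewrite !lambda_surjectiveP -/n -xE (_ : n.+1%:Z - i%:Z = n%:Z - i%:Z + 1); last by lia.
by split; [apply: colim_surjective_remove | apply: colim_surjective_insert].
Qed.

Lemma lambda_surjective_insert_cat (l1 l2 l3 : seq R) i :
  (forall y, y \in l2 -> ideal_gen [set r | r \in l1 ++ l3] y) ->
  lambda_surj_nat (size (l1 ++ l2 ++ l3)) (nth 0 (l1 ++ l2 ++ l3)) i <->
  lambda_surj_nat (size (l1 ++ l3)) (nth 0 (l1 ++ l3)) i.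
Proof.
elim: l2 => // y l2 IHl hl2.
rewrite -IHl; last by move=> z zl2; apply: hl2; rewrite mem_behead.
apply: lambda_surjective_insert.
have : ideal_gen [set r | r \in l1 ++ l3] y by apply: hl2; rewrite mem_head.
apply: submodule_genS => r /=; rewrite !mem_cat => /orP[->//|->].
by rewrite !orbT.
Qed.

(** Both families are compared with their concatenation, obtained from either one by inserting
    elements of the ideal it generates. *)
Lemma lambda_surjective_generators s t (g : 'I_s -> R) (b : 'I_t -> R) i :
  ideal_gen (range g) = ideal_gen (range b) ->
  lambda_surjective M g i -> lambda_surjective M b i.
Proof.
have codomE n (f : 'I_n -> R) : lambda_surj_nat (size (codom f)) (nth 0 (codom f)) i <->
    lambda_surjective M f i.
  rewrite /lambda_surj_nat size_codom card_ord.
  rewrite (_ : (fun j : 'I_n => nth 0 (codom f) j) = f) //.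
  by apply/funext => j; rewrite -[j in RHS](nth_ord_enum j) -(nth_map _ 0) ?size_enum_ord.
have rangeE n (f : 'I_n -> R) : range f = [set r | r \in codom f].
  by apply/seteqP; split=> [_ [j _ <-]|r /codomP[j ->]]; [apply: codom_f | exists j].
rewrite !rangeE => gen_gb.
have [|_ g_gb] := @lambda_surjective_insert_cat (codom g) (codom b) [::] i.
  by move=> y yb; rewrite cats0 gen_gb; apply: sub_ideal_gen.
have [|gb_b _] := @lambda_surjective_insert_cat [::] (codom g) (codom b) i.
  by move=> y yg; rewrite /= -gen_gb; apply: sub_ideal_gen.
by move=> /codomE lg; apply/codomE; apply: gb_b; move: g_gb; rewrite !cats0; apply.
Qed.

End GeneratorIndependence.

(** * Weak sequences *)

Section WeakSequence.
Variables (R : comPzRingType) (R_noeth : noetherian R).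
Variables (M : lmodType R) (M_max : maximum_condition M).
Variables (s : nat) (b : 'I_s -> R) (a : set R).
Hypothesis gen_b : ideal_gen (range b) = a.
Implicit Types (N : set M).

Let a_ideal : is_ideal a. Proof. by rewrite -gen_b; apply: ideal_genP. Qed.

Let a_b j : a (b j).
Proof. by rewrite -gen_b; apply: sub_ideal_gen; exists j. Qed.

Definition surjective_below N c :=
  forall i : nat, (i < c)%N -> colim_surjective N b (s%:Z - i%:Z).

Lemma colon_gen N m : is_submodule N -> (forall j, N (b j *: m)) -> colon N a m.
Proof.
move=> sN bm; rewrite -gen_b; apply: ideal_gen_min; first exact: colon_ideal.
by move=> _ [j _ <-]; apply: bm.
Qed.

Lemma power_torsion_colon N c : is_submodule N -> surjective_below N c.+1 ->
  power_torsion a N `<=` colon N a.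
Proof.
move=> sN surj m tors_m; apply: colon_gen => //.
apply: colim_surjective_power_torsion => // [|j]; last exact: tors_m.
by rewrite -[s%:Z]subr0; apply: surj.
Qed.

(** One degree is lost because degree i for N + yM uses degrees i and i + 1 for N. *)
Lemma surjective_below_add_mul N c y : is_submodule N -> a y ->
  colon N [set y] `<=` colon N a -> surjective_below N c.+1 ->
  surjective_below (add_mul N y) c.
Proof.
move=> sN ay yN surj i lt_ic; apply: colim_surjective_add_mul => //.
- by rewrite gen_b.
- by lia.
- by move=> m Nym j; apply: (yN m) => // _ ->.
- by apply: surj; lia.
- by rewrite (_ : _ - 1 = s%:Z - i.+1%:Z); [apply: surj; lia | lia].
Qed.

(** If [y ^+ k.+2] sends m into N, then so does [r * y ^+ k.+1] for r in a, and the induction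
    hypothesis for [r *: m] gives [r ^+ 2 *: m] in N. Thus m is torsion modulo N, and a kills
    torsion. *)
Lemma colon_power N c y k : is_submodule N -> a y ->
  colon N [set y] `<=` colon N a -> surjective_below N c.+1 ->
  colon N [set y ^+ k.+1] `<=` colon N a.
Proof.
move=> sN ay yN surj; elim: k => [|k IHk] m; first by rewrite expr1 => /yN.
move=> /(_ _ erefl) Nym; apply: (power_torsion_colon sN surj) => r ar.
exists 2%N; rewrite expr2 -scalerA.
apply: (IHk (r *: m)) => // _ ->; rewrite scalerA mulrC -scalerA.
by apply: (yN (y ^+ k.+1 *: m)) => // _ ->; rewrite scalerA -exprS.
Qed.

(** The elements of X generate a up to radical modulo the annihilator of M/N, phrased through primes
    as prime avoidance requires. *)
Definition radical_cover N (X : seq R) := forall P, prime_ideal P ->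
  (forall r, (forall m, N (r *: m)) -> P r) -> (forall x, x \in X -> P x) -> a `<=` P.

(* Induction on the length of X: some y in x2 + <x1, X> is filter regular on
   M/N, and the powers y^k replace x2; then a kills N :_M x1 modulo every
   N + y^k M, hence modulo N by Krull's intersection theorem. *)
Lemma colon_first N x1 (X : seq R) : a `<=` jacobson_radical R ->
  is_submodule N -> a x1 -> (forall x, x \in X -> a x) -> radical_cover N (x1 :: X) ->
  surjective_below N (size X).+1 -> colon N [set x1] `<=` colon N a.
Proof.
move=> a_jac; elim: X N => [|x2 X IHX] N sN ax1 aX radN surj.
  (* With no further elements, every prime containing [x1] and the annihilator of M/N contains a;
     avoidance in the coset of the zero ideal then says that [x1] itself is filter regular. *)
  apply: subset_trans (power_torsion_colon sN surj).
  have [|||_ -> /(_ tt)] := filter_regular_in_coset R_noeth M_max (a := a)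
    (K := unit) (N := fun=> N) (w := x1) (I := [set 0]); last by rewrite addr0.
  - by [].
  - exact: (@submod_set0 R R^o).
  - by move=> _ P pP NP Px1 _; apply: radN => // x; rewrite inE => /eqP->.
pose I := ideal_gen [set x | x \in x1 :: X].
have sI : is_ideal I by apply: ideal_genP.
have Ia : I `<=` a.
  apply: ideal_gen_min => // x; rewrite /= inE => /orP[/eqP->//|xX].
  by apply: aX; rewrite inE xX orbT.
have [|||r Ir /(_ tt) yN] := filter_regular_in_coset R_noeth M_max (a := a)
    (K := unit) (N := fun=> N) (w := x2) (I := I).
- by [].
- by [].
- move=> _ P pP NP Px2 IP; apply: radN => // x; rewrite !inE => /or3P[/eqP->|/eqP->//|xX].
    by apply: IP; apply: sub_ideal_gen; rewrite /= mem_head.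
  by apply: IP; apply: sub_ideal_gen; rewrite /= inE xX orbT.
set y := x2 + r in yN.
have ay : a y by apply: idealD => //; [apply: aX; rewrite mem_head | apply: Ia].
have yNa : colon N [set y] `<=` colon N a.
  exact: subset_trans (power_torsion_colon sN surj).
move=> m Nx1m q aq; apply: (krull_intersection R_noeth M_max sN (y := y)) => [q'|m'|[//|k] _].
- by apply: a_jac; apply: ideal_mull.
- move=> Nyy; apply: (colon_power (k := 1) sN ay yNa surj (t := m') _ ay) => _ ->.
  by rewrite expr2 -scalerA.
have sN' := add_mul_sub (y ^+ k.+1) sN.
apply: (IHX _ sN') aq => //.
- by move=> x xX; apply: aX; rewrite inE xX orbT.
- move=> P pP NP XP; apply: radN => // [t Nt|x].
    by apply: NP => m'; apply: sub_add_mul.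
  have [sP _ _] := pP.
  have IP : I `<=` P by apply: ideal_gen_min.
  rewrite !inE => /or3P[/eqP->|/eqP->|xX].
  + by apply: XP; rewrite mem_head.
  + rewrite -(addrK r x2); apply: idealB => //; last exact: IP.
    (* P contains [y ^+ k.+1], which kills the new quotient, hence y, and so [x2], as [x2] is y
       minus the element r of I. *)
    apply: (@prime_exp _ _ _ k.+1) => //; apply: NP => m'.
    exact: add_mul_mem.
  + by apply: XP; rewrite inE xX orbT.
- apply: (surjective_below_add_mul sN _ _ surj); last exact: colon_power sN ay yNa surj.
  by rewrite exprS; apply: (ideal_mulr _ a_ideal).
by move=> _ ->; apply: sub_add_mul; apply: Nx1m.
Qed.

Lemma surjective_weak_sequence c (x : 'I_c -> R) : a `<=` jacobson_radical R ->
  (forall j, a (x j)) -> same_radical a M x ->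
  (forall i, (i < c)%N -> lambda_surjective M b i) -> weak_sequence a M x.
Proof.
move=> a_jac ax rad_x surj.
pose N k := ideal_span M (x @` [set j : 'I_c | (j < k)%N]).
have sN k : is_submodule (N k) by apply: ideal_span_sub.
(* [colon_first] is applied with [x i] first and the later elements as the list; the earlier ones
   already annihilate the quotient by [N i]. *)
have colonN (i : 'I_c) : surjective_below (N i) (c - i) -> colon (N i) [set x i] `<=` colon (N i) a.
  have -> : (c - i)%N = (size (drop i.+1 (codom x))).+1.
    by rewrite size_drop size_codom card_ord; have := ltn_ord i; lia.
  have xE : drop i (codom x) = x i :: drop i.+1 (codom x).
    rewrite (drop_nth 0) ?size_codom ?card_ord //; congr (_ :: _).
    by rewrite (nth_map i) ?size_enum_ord // nth_ord_enum.
  apply: colon_first => // [y /mem_drop/codomP[j ->]//|].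
  move=> P pP NP xP r ar; have [sP _ _] := pP.
  have Px j : P (x j).
    have [lt_ji|le_ij] := ltnP j i.
      apply: NP => m; apply: ideal_span_mem; apply: sub_ideal_gen.
      by exists j.
    apply: xP; rewrite -xE; apply/(nthP 0); exists (j - i)%N.
      by rewrite size_drop size_codom card_ord; have := ltn_ord j; lia.
    by rewrite nth_drop subnKC // (nth_map i) ?size_enum_ord // nth_ord_enum.
  have : radical_mod (annihilator M) a r.
    exists 1%N, r => // m; rewrite expr1 subrr scale0r //.
  rewrite -rad_x => -[n [y xy rny]]; apply: (prime_exp (n := n) pP).
  rewrite -(subrK y (r ^+ n)); apply: idealD => //.
    by apply: NP => m; rewrite rny; apply: submod0.
  by apply: ideal_gen_min xy => // _ [j _ <-].
have surjN k : (k <= c)%N -> surjective_below (N k) (c - k).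
  elim: k => [_|k IHk lt_kc].
    rewrite /N (_ : [set j | _] = set0); last by apply/seteqP; split.
    rewrite image_set0 ideal_span_set0 subn0 => i lt_ic.
    by apply/lambda_surjectiveP; apply: surj.
  pose i := Ordinal lt_kc.
  rewrite /N (_ : [set j : 'I_c | (j < k.+1)%N] = i |` [set j : 'I_c | (j < k)%N]); last first.
    apply/seteqP; split=> j /=; last by move=> [->|/ltnW].
    by rewrite ltnS leq_eqVlt => /orP[/eqP ?|]; [left; apply: val_inj | right].
  rewrite image_setU image_set1 ideal_span_setU1.
  have surj_k : surjective_below (N i) (c - i) := IHk (ltnW lt_kc).
  apply: surjective_below_add_mul; [exact: sN | exact: ax | exact: (colonN i) |].
  by rewrite -subSn // subSS.
by move=> i; apply: colonN; apply: surjN; apply: ltnW.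
Qed.

End WeakSequence.

(** * f-generating sets and d-sequences *)

Section FGeneratingSets.
Variables (R : comPzRingType) (R_noeth : noetherian R).
Variables (M : lmodType R) (M_max : maximum_condition M).
Variable a : set R.
Implicit Types (N : set M).

Definition filter_regular_elt N (y : R) : Prop :=
  colon N [set y] `<=` power_torsion a N.

(** From xm = ym' modulo N, filter regularity of y gives r^u m' = xm'' modulo N; then x sends r^u m
    - ym'' into N, and filter regularity of x concludes. *)
Lemma filter_regular_elt_swap N x y : is_submodule N ->
  filter_regular_elt N x -> filter_regular_elt (add_mul N x) y ->
  filter_regular_elt (add_mul N y) x.
Proof.
move=> sN xreg yreg m /(_ _ erefl)[m' Nxy] r ar.
have [|u [m'' Num]] := yreg m' _ r ar.
  by move=> _ ->; exists m; apply: submodB_sym.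
have [|u' Nu'] := xreg (r ^+ u *: m - y *: m'') _ r ar.
  move=> _ ->; have := submodD sN (submodZ sN (r ^+ u) Nxy) (submodZ sN y Num).
  by rewrite !scalerBr !scalerA !(mulrC _ (r ^+ u)) (mulrC y x) addrA subrK.
exists (u' + u)%N; exists (r ^+ u' *: m''); move: Nu'.
by rewrite scalerBr !scalerA -exprD mulrC.
Qed.

Lemma ideal_pow_sub s (b : 'I_s -> R) (J : set R) : ideal_gen (range b) = a ->
  is_ideal J -> (forall j, exists u, J (b j ^+ u)) -> exists t, ideal_pow a t `<=` J.
Proof.
move=> gen_b sJ bJ.
have [t tP] : exists t, forall q : seq R, (t <= size q)%N ->
    (forall r, r \in q -> ideal_gen [set x | x \in codom b] r) -> J (\prod_(r <- q) r).
  have : forall y, y \in codom b -> exists u, J (y ^+ u) by move=> _ /codomP[j ->].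
  elim: (codom b) => [_|y l IHl hl].
    exists 1%N => -[//|r q] _ qP; rewrite big_cons.
    have -> : r = 0; last by rewrite mul0r; apply: ideal0.
    have : ideal_gen [set x | x \in [::]] `<=` [set (0 : R)].
      by apply: ideal_gen_min => //; apply: (@submod_set0 R R^o).
    by apply; apply: qP; rewrite mem_head.
  have [|t tP] := IHl; first by move=> z zl; apply: hl; rewrite inE zl orbT.
  have [u Ju] := hl y (mem_head _ _); exists (u + t)%N.
  (* The factors in q are split one at a time into a multiple of y and an element of the span of
     [l], counted by e and [q']. Once q is empty, at least u factors y or at least t factors in that
     span are present. *)
  have key e (q' q : seq R) : (u + t <= e + size q' + size q)%N ->
      (forall r, r \in q' -> ideal_gen [set x | x \in l] r) ->
      (forall r, r \in q -> ideal_gen [set x | x \in y :: l] r) ->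
      J (y ^+ e * (\prod_(r <- q') r) * (\prod_(r <- q) r)).
    elim: q e q' => [|f q IHq] e q' /= le_ut q'P qP.
      rewrite big_nil mulr1; have [le_ue|lt_eu] := leqP u e.
        by apply: ideal_mulr => //; apply: ideal_expS Ju.
      by apply: ideal_mull => //; apply: tP => //; lia.
    have [z zP] : cyclic_ext (ideal_gen [set x | x \in l] : set R^o) y f.
      by apply: (@submodule_gen_cons R R^o); apply: qP; rewrite mem_head.
    have qP' r : r \in q -> ideal_gen [set x | x \in y :: l] r.
      by move=> rq; apply: qP; rewrite inE rq orbT.
    have J1 := IHq e.+1 q' ltac:(lia) q'P qP'.
    have J2 : J (y ^+ e * (\prod_(r <- (f - z * y) :: q') r) * (\prod_(r <- q) r)).
      by apply: IHq => //= [|r]; [lia | rewrite inE => /orP[/eqP->|/q'P]].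
    have := idealD sJ (ideal_mull z sJ J1) J2; rewrite !big_cons exprS.
    by congr (J _); ring.
  by move=> q le_q qP; have := key 0%N [::] q le_q; rewrite big_nil expr0 !mul1r; apply.
exists t; apply: ideal_gen_min => // _ [f fa ->].
rewrite -big_enum -(big_map f xpredT id); apply: tP.
  by rewrite size_map -cardE card_ord.
move=> r /mapP[k _ ->]; have := fa k; rewrite -gen_b.
by apply: submodule_genS => _ [j _ <-]; apply: codom_f.
Qed.

Lemma power_torsion_ideal_pow s (b : 'I_s -> R) N : ideal_gen (range b) = a ->
  is_submodule N -> power_torsion a N `<=` \bigcup_t colon N (ideal_pow a t).
Proof.
move=> gen_b sN m tors_m.
have [|t tP] := ideal_pow_sub gen_b (colon_ideal m sN).
  by move=> j; apply: tors_m; rewrite -gen_b; apply: sub_ideal_gen; exists j.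
by exists t.
Qed.

(** Sets of positions replace prefixes, so that the order of the generators no longer matters. *)
Definition span_of t (g : 'I_t -> R) (S : {set 'I_t}) : set M :=
  ideal_span M (g @` [set j | j \in S]).

Lemma span_of_eq t (g g' : 'I_t -> R) (S : {set 'I_t}) :
  (forall j, j \in S -> g j = g' j) -> span_of g S = span_of g' S.
Proof.
move=> gg'; congr (ideal_span M _); apply/seteqP.
by split=> _ [j jS <-]; exists j; rewrite ?gg'.
Qed.

Lemma span_ofU1 t (g : 'I_t -> R) (S : {set 'I_t}) k :
  span_of g (k |: S)%SET = add_mul (span_of g S) (g k).
Proof.
rewrite -ideal_span_setU1; congr (ideal_span M _); apply/seteqP; split=> r.
  by move=> [j /=]; rewrite !inE => /orP[/eqP->|jS] <-; [left | right; exists j].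
move=> [->|[j jS <-]]; first by exists k => //=; rewrite setU11.
by exists j => //=; rewrite !inE (jS : j \in S) orbT.
Qed.

(* Replace the generators one after the other, g k by an element of
   g k + <g j : j != k>, which keeps the generated ideal. *)
Lemma exists_ordered_filter_regular t (b : 'I_t -> R) : ideal_gen (range b) = a ->
  exists2 g : 'I_t -> R, ideal_gen (range g) = a &
    forall (k : 'I_t) (S : {set 'I_t}), (forall j, j \in S -> (j < k)%N) ->
      filter_regular_elt (span_of g S) (g k).
Proof.
move=> gen_b.
have key n : (n <= t)%N -> exists2 g : 'I_t -> R, ideal_gen (range g) = a &
    forall (k : 'I_t) (S : {set 'I_t}), (k < n)%N -> (forall j, j \in S -> (j < k)%N) ->
      filter_regular_elt (span_of g S) (g k).
  elim: n => [_|n IHn lt_nt]; first by exists b.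
  have [g gen_g greg] := IHn (ltnW lt_nt); pose i := Ordinal lt_nt.
  pose I := ideal_gen (g @` [set j | j != i]).
  (* One r serves all subsets S of positions at once; a prime containing [g i] and I contains all
     generators, hence a. *)
  have [|||r Ir rP] := filter_regular_in_coset R_noeth M_max (a := a)
    (N := span_of g) (w := g i) (I := I).
  - by move=> S; apply: ideal_span_sub.
  - exact: ideal_genP.
  - move=> S P [sP _ _] _ Pgi IP; rewrite -gen_g; apply: ideal_gen_min => // _ [j _ <-].
    have [->//|ji] := eqVneq j i.
    by apply: IP; apply: sub_ideal_gen; exists j.
  pose g' j := if j == i then g i + r else g j.
  have g'i : g' i = g i + r by rewrite /g' eqxx.
  have g'E j : j != i -> g' j = g j by rewrite /g' => /negPf->.
  have span_g' (k : 'I_t) (S : {set 'I_t}) : (k <= n)%N ->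
      (forall j, j \in S -> (j < k)%N) -> span_of g' S = span_of g S.
    move=> le_kn Sk; apply: span_of_eq => j /Sk lt_jk; apply: g'E.
    by apply: contraTneq lt_jk => ->; rewrite -leqNgt.
  exists g'.
    have I_g (f : 'I_t -> R) : (forall j, j != i -> f j = g j) -> I `<=` ideal_gen (range f).
      move=> fg; apply: ideal_gen_min; first exact: ideal_genP.
      by move=> _ [j ji <-]; apply: sub_ideal_gen; exists j => //; apply: fg.
    rewrite -gen_g; apply/seteqP; split.
      apply: ideal_gen_min; [exact: ideal_genP | move=> _ [j _ <-]].
      have [->|ji] := eqVneq j i; last by rewrite g'E //; apply: sub_ideal_gen; exists j.
      rewrite g'i; apply: (idealD (ideal_genP _)).
        by apply: sub_ideal_gen; exists i.
      exact: I_g.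
    apply: ideal_gen_min; [exact: ideal_genP | move=> _ [j _ <-]].
    have [->|ji] := eqVneq j i; last by rewrite -g'E //; apply: sub_ideal_gen; exists j.
    rewrite -(addrK r (g i)) -g'i; apply: (idealB (ideal_genP _)).
      by apply: sub_ideal_gen; exists i.
    exact: I_g.
  move=> k S; rewrite ltnS => le_kn Sk; rewrite (span_g' k) //.
  have [ki|ki] := eqVneq k i; first by rewrite ki g'i; apply: rP.
  rewrite g'E //; apply: greg => //; rewrite ltn_neqAle le_kn andbT.
  by apply: contraNneq ki => kn; apply/eqP/val_inj.
by have [g gen_g greg] := key t (leqnn t); exists g => // k S; apply: greg.
Qed.

(** Induction on the size of S. If S has an element beyond k, its largest element l is removed by
    the swap: [g k] is handled by induction over the rest of S, and [g l] by hypothesis over the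
    rest together with k. *)
Lemma filter_regular_reorder t (g : 'I_t -> R) :
  (forall (k : 'I_t) (S : {set 'I_t}), (forall j, j \in S -> (j < k)%N) ->
     filter_regular_elt (span_of g S) (g k)) ->
  forall (k : 'I_t) (S : {set 'I_t}), k \notin S -> filter_regular_elt (span_of g S) (g k).
Proof.
move=> greg k S; have [n] := ubnP #|S|; elim: n => // n IHn in S * => leSn kS.
have [Sk|] := pselect (forall j, j \in S -> (j < k)%N); first exact: greg.
move=> nSk; have [j jS le_kj] : exists2 j, j \in S & (k <= j)%N.
  apply: contrapT => h; apply: nSk => j jS; rewrite ltnNge; apply/negP => le_kj.
  by apply: h; exists j.
case: (arg_maxnP (fun i : 'I_t => i : nat) jS) => l lS maxl.
have lt_kl : (k < l)%N.
  rewrite ltn_neqAle (leq_trans le_kj (maxl j jS)) andbT.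
  by apply: contraNneq kS => /val_inj->.
rewrite -(finset.setD1K lS) span_ofU1; apply: filter_regular_elt_swap.
- exact: ideal_span_sub.
- apply: IHn; first by move: leSn; rewrite (cardsD1 l) (lS : l \in S).
  by rewrite !inE negb_and kS orbT.
rewrite -span_ofU1; apply: greg => i; rewrite !inE => /orP[/eqP->//|/andP[il iS]].
by rewrite ltn_neqAle andbC; apply/andP; split; [apply: maxl | ].
Qed.

Lemma exists_f_generating t (b : 'I_t -> R) : ideal_gen (range b) = a ->
  exists g : 'I_t -> R, f_generating a M g.
Proof.
move=> /exists_ordered_filter_regular[g gen_g /filter_regular_reorder greg].
exists g; split=> // s i.
have -> : ideal_mul M (prefix_ideal (g \o s) i) =
          span_of g [set s j | j in [set j : 'I_t | (j < i)%N]]%SET.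
  congr (ideal_mul M (ideal_gen _)); apply/seteqP; split=> _ [j /= ji <-].
    by exists (s j) => //=; apply: imset_f; rewrite inE.
  by move: ji => /imsetP[k]; rewrite inE => ki ->; exists k.
apply: subset_trans (power_torsion_ideal_pow gen_g (ideal_span_sub _ _)).
apply: greg; apply/imsetP => -[j]; rewrite inE => lt_ji /perm_inj ij.
by rewrite ij ltnn in lt_ji.
Qed.

End FGeneratingSets.

(** * Relative systems of parameters under powers and permutations *)

Section RelativeSop.
Variables (R : comPzRingType) (a : set R) (M : lmodType R).
Hypothesis a_ideal : is_ideal a.

Lemma relative_sop_powers r (x : 'I_r -> R) (e : 'I_r -> nat) :
  (forall j, 0 < e j)%N -> relative_sop a M x -> relative_sop a M (fun j => x j ^+ e j).
Proof.
move=> e_gt0 [cd_r ax rad_x]; split=> // [j|].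
  by rewrite -(prednK (e_gt0 j)) exprS; apply: ideal_mulr.
rewrite /same_radical -rad_x; apply/seteqP; split=> t [n [y xy ty]].
  exists n, y => //; move: xy; apply: ideal_gen_min => [|_ [j _ <-]]; first exact: ideal_genP.
  rewrite -(prednK (e_gt0 j)) exprS; apply: (ideal_mulr _ (ideal_genP _)).
  by apply: sub_ideal_gen; exists j.
(* [t ^+ n - y] kills M and divides [t ^+ (n * k) - y ^+ k]. *)
have [k yk] := ideal_gen_powers e xy; exists (n * k)%N, (y ^+ k) => // m.
by rewrite exprM subrXX mulrC -scalerA ty scaler0.
Qed.

Lemma relative_sop_perm r (x : 'I_r -> R) (s : 'S_r) :
  relative_sop a M x -> relative_sop a M (x \o s).
Proof.
move=> [cd_r ax rad_x]; split=> // [j|]; first exact: ax.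
rewrite /same_radical -rad_x; congr (radical_mod _ (ideal_gen _)).
apply/seteqP; split=> _ [j _ <-]; first by exists (s j).
by exists (s^-1%g j) => //=; rewrite permKV.
Qed.

Hypothesis sop_weak : forall r (x : 'I_r -> R), relative_sop a M x -> weak_sequence a M x.

(* If x_i x_j m lies in N = <x_1, ..., x_(i-1)>M, then so does x_j^2 m, because
   a kills (N : x_i)/N; now x_1, ..., x_(i-1), x_j^2 starts another s.o.p. *)
Lemma relative_sop_d_sequence r (x : 'I_r -> R) : relative_sop a M x -> d_sequence M x.
Proof.
move=> sop_x i j le_ij; have [cd_r ax _] := sop_x.
set N := ideal_mul M _; have sN : is_submodule N by apply: submodule_gen_sub.
apply/seteqP; split=> m Nm _ ->; last first.
  by rewrite -scalerA; apply: (submodZ sN); apply: Nm.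
have Njj : N (x j ^+ 2 *: m).
  rewrite expr2 -scalerA; apply: (sop_weak sop_x (i := i) (t := x j *: m)) => // _ ->.
  by rewrite scalerA; apply: Nm.
(* Exchanging positions i and j and squaring at i puts [x j ^+ 2] at place i; the entries before i
   stay fixed because i <= j. *)
pose e (k : 'I_r) := if k == i then 2%N else 1%N.
pose x' k := x (tperm i j k) ^+ e k.
have sop_x' : relative_sop a M x'.
  apply: (relative_sop_powers (x := x \o tperm i j)); last exact: relative_sop_perm.
  by move=> k; rewrite /e; case: ifP.
have prefixE : prefix_ideal x' i = prefix_ideal x i.
  have x'E (k : 'I_r) : (k < i)%N -> x' k = x k.
    move=> lt_ki; rewrite /x' /e tpermD; last 2 first.
    - by apply: contraTneq lt_ki => <-; rewrite ltnn.
    - by apply: contraTneq lt_ki => <-; rewrite -leqNgt.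
    by case: eqP lt_ki => [->|_ _]; rewrite ?ltnn // expr1.
  by congr (ideal_gen _); apply/seteqP; split=> _ [k ki <-]; exists k; rewrite ?x'E.
have := sop_weak sop_x' (i := i) (t := m); rewrite prefixE; apply=> // _ ->.
by rewrite /x' /e eqxx tpermL.
Qed.

Lemma relative_sop_usd r (x : 'I_r -> R) : relative_sop a M x -> usd_sequence M x.
Proof.
move=> sop_x s e e_gt0; apply: relative_sop_d_sequence.
exact: relative_sop_powers (relative_sop_perm _ _).
Qed.

End RelativeSop.

Theorem theorem4p2 (R : comPzRingType) (R_noeth : noetherian R)
    (a : set R) (a_ideal : is_ideal a)
    (M : lmodType R) (M_fg : finitely_generated M)
    (c : nat) (cd_c : cd a M = c%:Z%:E%E) (ara_c : ara a M = c%:Z%:E%E)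
    (c_gt0 : (0 < c)%N) :
  let cond_i :=
    forall (t : nat) (b : 'I_t -> R), ideal_gen (range b) = a ->
      forall i : nat, (i <= c - 1)%N -> lambda_surjective M b i in
  let cond_ii :=
    exists (s : nat) (g : 'I_s -> R), f_generating a M g /\
      forall i : nat, (i <= c - 1)%N -> lambda_surjective M g i in
  let cond_iii := relative_Buchsbaum a M in
  let cond_iv :=
    forall (r : nat) (x : 'I_r -> R), relative_sop a M x -> usd_sequence M x in
  [/\ cond_i <-> cond_ii,
      cond_iii -> cond_iv &
      a `<=` jacobson_radical R -> cond_i -> cond_iii].

Proof.
move=> cond_i cond_ii cond_iii cond_iv.
have M_max := fg_max_cond R_noeth M_fg.
have [t [b gen_b]] := R_noeth a a_ideal.
have lt_c i : (i < c)%N -> (i <= c - 1)%N by lia.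
split.
- split=> [hi|[s [g [[gen_g _] surj_g]]] t' b' gen_b' i le_ic].
    have [g fg] := exists_f_generating R_noeth M_max gen_b.
    by exists t, g; split=> // i le_ic; apply: hi => //; case: fg.
  by apply: lambda_surjective_generators (surj_g i le_ic); rewrite gen_g.
- by move=> [_ sop_weak] r x; apply: relative_sop_usd.
move=> a_jac hi; split=> [|r x [cd_r ax rad_x]]; first by rewrite cd_c ara_c.
(* An s.o.p. has length cd = c, so the surjectivity in degrees up to c - 1 covers every degree below
   its length. *)
have rc : r = c by move: cd_r; rewrite cd_c => -[->].
apply: (surjective_weak_sequence R_noeth M_max gen_b) => // i.
by rewrite rc => /lt_c; apply: hi.
Qed.
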